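(* There exists a Gorenstein* poset of rank $9$ whose Eulerian Chow polynomial is not log-concave, and hence is not real-rooted.
   Context: Posets are finite, bounded (with minimum $\widehat 0$ and maximum $\widehat 1$) and graded with rank function $\rho$ (length of maximal chains from $\widehat 0$); the rank of $P$ is $\rho(\widehat 1)$ and $\rho_{st}=\rho(t)-\rho(s)$. $P$ is Eulerian if its Möbius function satisfies $\mu_{st}=(-1)^{\rho_{st}}$ for all $s\le t$. $P$ is Cohen--Macaulay (over $\mathbb Q$) if for every open interval $J$ of $P$ (of the form $(s,t)$, $P_{<t}$ or $P_{>s}$ with $s<t$ in $P$) the order complex $\Delta(J)$ (simplicial complex of chains of $J$) satisfies $\widetilde H_i(\Delta(J);\mathbb Q)=0$ for all $i<\dim\Delta(J)$. $P$ is Gorenstein* if it is both Eulerian and Cohen--Macaulay. Eulerian Chow polynomial: in the incidence algebra of $P$ over $\mathbb Z[x]$ (functions $a$ on closed intervals with values $a_{st}(x)\in\mathbb Z[x]$, product $(ab)_{st}=\sum_{s\le w\le t}a_{sw}b_{wt}$), let $\overline\varepsilon_{st}=(x-1)^{\rho_{st}-1}$ for $s<t$ and $\overline\varepsilon_{ss}=-1$. Put $\mathrm H=-(\overline\varepsilon)^{-1}$. The Eulerian Chow polynomial of an Eulerian poset $P$ is $\mathrm H_P(x)=\mathrm H_{\widehat 0\widehat 1}(x)$. A polynomial $\sum_i a_ix^i$ with nonnegative coefficients is log-concave if $a_i^2\ge a_{i-1}a_{i+1}$ for all $i$; it is real-rooted if all its complex roots are real. *)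

(* Defs.v *)
From HB Require Import structures.
From mathcomp Require Import all_boot all_order all_algebra all_field.

Set Implicit Arguments.
Unset Strict Implicit.
Unset Printing Implicit Defensive.

Import Order.TTheory GRing.Theory Num.Theory.
Local Open Scope ring_scope.

(* The finite bounded posets are the instances of [finTBPOrderType]; the      *)
(* minimum and the maximum are [\bot%O] and [\top%O].                         *)

Section GradedPosets.
Context {d : Order.disp_t} {P : finTBPOrderType d}.
Implicit Types (s t x y : P) (C : {set P}).

Definition is_chain C : bool :=
  [forall x in C, forall y in C, (x >=< y)%O].

Definition maximal_chain C : bool := maxset is_chain C.

Definition graded : Prop :=
  forall C D, maximal_chain C -> maximal_chain D -> #|C| = #|D|.

(* Length of a longest chain of [\bot, t] (a chain with k+1 elements has      *)
(* length k); if P is graded, all the maximal chains of [\bot, t] have this   *)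
(* length.                                                                    *)
Definition rho t : nat :=
  (\max_(C : {set P} | is_chain C && [forall x in C, (x <= t)%O]) #|C|).-1.

Definition rho_int s t : nat := (rho t - rho s)%N.

Definition poset_rank : nat := rho \top%O.

End GradedPosets.

Arguments graded {d} P.
Arguments poset_rank {d} P.

(* An element of the incidence algebra of P over R is represented by a        *)
(* function [P -> P -> R], of which only the values at pairs s <= t are used. *)

Section IncidenceAlgebra.
Context {d : Order.disp_t} {P : finTBPOrderType d} {R : unitRingType}.
Implicit Types (a b : P -> P -> R) (s t w : P).

Definition inc_mul a b : P -> P -> R :=
  fun s t => \sum_(w : P | (s <= w <= t)%O) a s w * b w t.

Definition inc_one : P -> P -> R := fun s t => (s == t)%:R.

(* Solves [inc_mul a b = inc_one] for b; n is fuel, and n = #|P| is enough.   *)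
Fixpoint inc_inv_rec a (n : nat) s t : R :=
  if n is n'.+1 then
    if s == t then (a s s)^-1
    else - ((a s s)^-1 *
            \sum_(w : P | (s < w <= t)%O) a s w * inc_inv_rec a n' w t)
  else 0.

Definition inc_inv a : P -> P -> R := inc_inv_rec a #|P|.

Lemma inc_mul_assoc a b c s t :
  inc_mul (inc_mul a b) c s t = inc_mul a (inc_mul b c) s t.
Proof.
rewrite /inc_mul.
under eq_bigr do rewrite mulr_suml.
under [RHS]eq_bigr do rewrite mulr_sumr.
rewrite (exchange_big_dep (fun w => (s <= w <= t)%O)) /=; last first.
  move=> w v /andP[_ wt] /andP[sv vw].
  by rewrite sv (le_trans vw wt).
apply: eq_bigr => v /andP[sv vt]; apply: eq_big => [w|w _]; last by rewrite mulrA.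
rewrite sv /=; apply/andP/andP => [[/andP[_ ->] ->] // | [vw ->]].
by rewrite vw (le_trans sv vw).
Qed.

Lemma eq_inc_mul a a' b b' s t :
    (forall w, (s <= w <= t)%O -> a s w = a' s w) ->
    (forall w, (s <= w <= t)%O -> b w t = b' w t) ->
  inc_mul a b s t = inc_mul a' b' s t.
Proof. by move=> ea eb; apply: eq_bigr => w sw; rewrite ea ?eb. Qed.

Lemma inc_mul1l a s t : (s <= t)%O -> inc_mul inc_one a s t = a s t.
Proof.
move=> st; rewrite /inc_mul (bigD1 s) ?lexx //= /inc_one eqxx mul1r big1 ?addr0 //.
by move=> w /andP[_]; rewrite eq_sym => /negbTE->; rewrite mul0r.
Qed.

Lemma inc_mul1r a s t : (s <= t)%O -> inc_mul a inc_one s t = a s t.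
Proof.
move=> st; rewrite /inc_mul (bigD1 t) ?lexx ?andbT //= /inc_one eqxx mulr1.
by rewrite big1 ?addr0 // => w /andP[_ /negbTE->]; rewrite mulr0.
Qed.

Lemma inc_inv_rec_fuel a (n : nat) s t :
    (#|[set w : P | (s <= w)%O]| <= n)%N ->
  inc_inv_rec a n.+1 s t = inc_inv_rec a n s t.
Proof.
elim: n s => [|n IHn] s le_n.
  by move: le_n; rewrite leqn0 cards_eq0 => /eqP/setP/(_ s); rewrite !inE lexx.
rewrite [LHS]/= [RHS]/=; case: ifP => // _; congr (- (_ * _)).
apply: eq_bigr => w /andP[lt_sw _]; congr (_ * _); apply: IHn.
rewrite -ltnS; apply: leq_trans le_n; apply: proper_card.
apply/properP; split; first by apply/subsetP=> v; rewrite !inE; apply: le_trans (ltW lt_sw).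
by exists s; rewrite !inE ?lexx // lt_geF.
Qed.

Lemma inc_inv_unfold a s t :
  inc_inv a s t =
    if s == t then (a s s)^-1
    else - ((a s s)^-1 *
            \sum_(w : P | (s < w <= t)%O) a s w * inc_inv a w t).
Proof. by rewrite /inc_inv -[LHS]inc_inv_rec_fuel ?max_card. Qed.

Lemma inc_inv_right a s t :
    (forall w, a w w \is a GRing.unit) -> (s <= t)%O ->
  inc_mul a (inc_inv a) s t = inc_one s t.
Proof.
move=> Ua st; rewrite /inc_mul (bigD1 s) ?lexx //= inc_inv_unfold /inc_one.
case: eqVneq => [->|_].
  rewrite mulrV // big1 ?addr0 // => w /andP[/andP[tw wt]].
  by rewrite eq_le tw wt.
rewrite mulrN mulrA divrr // mul1r addrC; apply/eqP; rewrite subr_eq0; apply/eqP.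
by apply: eq_bigl => w; rewrite lt_neqAle eq_sym; case: eqP; rewrite ?andbT ?andbF.
Qed.

Lemma inc_inv_left a s t :
    (forall w, a w w \is a GRing.unit) -> (s <= t)%O ->
  inc_mul (inc_inv a) a s t = inc_one s t.
Proof.
move=> Ua st; pose b := inc_inv a; pose c := inc_inv b.
have Ub w : b w w \is a GRing.unit by rewrite /b inc_inv_unfold eqxx unitrV.
have ac v w : (v <= w)%O -> a v w = c v w.
  move=> vw; rewrite -[LHS]inc_mul1r //.
  rewrite (@eq_inc_mul _ a _ (inc_mul b c)) //; last first.
    by move=> u /andP[_ uw]; rewrite inc_inv_right.
  rewrite -inc_mul_assoc (@eq_inc_mul _ inc_one _ c) ?inc_mul1l //.
  by move=> u /andP[vu _]; rewrite inc_inv_right.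
rewrite -(inc_inv_right Ub st); apply: eq_inc_mul => // w /andP[_ wt].
exact: ac.
Qed.

End IncidenceAlgebra.

Section Eulerian.
Context {d : Order.disp_t} (P : finTBPOrderType d).

Definition zeta : P -> P -> int := fun _ _ => 1.

Definition mobius : P -> P -> int := inc_inv zeta.

Definition eulerian : Prop :=
  forall s t : P, (s <= t)%O -> mobius s t = (-1) ^+ rho_int s t.

Definition eps_bar : P -> P -> {poly int} :=
  fun s t => if s == t then -1 else ('X - 1) ^+ (rho_int s t).-1.

Definition chow_function : P -> P -> {poly int} :=
  fun s t => - inc_inv eps_bar s t.

Definition eulerian_chow_poly : {poly int} := chow_function \bot%O \top%O.

Lemma eps_bar_unit (s : P) : eps_bar s s \is a GRing.unit.
Proof. by rewrite /eps_bar eqxx unitrN1. Qed.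

End Eulerian.

(* Reduced simplicial homology over the rationals of an abstract simplicial   *)
(* complex [D : {set {set T}}]. The simplices, the empty one included, are    *)
(* oriented by the enumeration of T. A chain is a rational function on        *)
(* {set T}; being an i-chain of D is a condition on its support.              *)

Section ReducedHomology.
Variable T : finType.
Implicit Types (D : {set {set T}}) (A : {set T}) (i : int).
Implicit Types c e : {ffun {set T} -> rat}.

Definition simplex_dim A : int := #|A|%:Z - 1.

(* The complex containing only the empty simplex has dimension -1.            *)
Definition complex_dim D : int := (\max_(A in D) #|A|)%:Z - 1.

Definition is_simplicial_chain D i c : Prop :=
  forall A, c A != 0 -> A \in D /\ simplex_dim A = i.

Definition incidence_sign A (x : T) : rat :=
  (-1) ^+ #|[set y in A | (enum_rank y < enum_rank x)%N]|.

(* The boundary of a simplex A is the sum over x in A of                      *)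
(* [incidence_sign A x] times A :\ x, and extends linearly to chains.         *)
Definition boundary c : {ffun {set T} -> rat} :=
  [ffun B : {set T} =>
     \sum_(A : {set T}) \sum_(x in A | A :\ x == B) incidence_sign A x * c A].

(* Every i-cycle is the boundary of an (i+1)-chain.                           *)
Definition reduced_homology_zero D i : Prop :=
  forall c, is_simplicial_chain D i c -> boundary c = 0 ->
  exists2 e, is_simplicial_chain D (i + 1) e & boundary e = c.

End ReducedHomology.

Section CohenMacaulay.
Context {d : Order.disp_t} (P : finTBPOrderType d).

Definition order_complex (J : {set P}) : {set {set P}} :=
  [set C : {set P} | is_chain C & C \subset J].

Definition homology_below_top_zero (J : {set P}) : Prop :=
  forall i : int, i < complex_dim (order_complex J) ->
    reduced_homology_zero (order_complex J) i.

Definition cohen_macaulay : Prop :=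
  forall s t : P, (s < t)%O ->
  [/\ homology_below_top_zero [set x | (s < x < t)%O],
      homology_below_top_zero [set x | (x < t)%O] &
      homology_below_top_zero [set x | (s < x)%O]].

Definition gorenstein_star : Prop := eulerian P /\ cohen_macaulay.

End CohenMacaulay.

Definition nonneg_coefs (p : {poly int}) : Prop := forall i, 0 <= p`_i.

(* The inequality at i.+1; at index 0 it reads a_0 ^ 2 >= 0.                  *)
Definition log_concave (p : {poly int}) : Prop :=
  forall i, p`_i * p`_i.+2 <= p`_i.+1 ^+ 2.

(* The complex roots of a nonzero integer polynomial are algebraic, hence lie *)
(* in algC.                                                                   *)
Definition real_rooted (p : {poly int}) : Prop :=
  forall z : algC, root (map_poly intr p) z -> z \is Num.real.

(* Main.v *)
Require Import Defs.
From HB Require Import structures.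
From mathcomp Require Import all_boot all_order all_algebra all_field.
From mathcomp Require Import ring zify.

Set Implicit Arguments.
Unset Strict Implicit.
Unset Printing Implicit Defensive.

Import Order.TTheory GRing.Theory Num.Theory.
Local Open Scope ring_scope.

(** Let d + 1 be the rank.  The Eulerian Chow polynomial is the sum of
    (X - 1)^(d - |C|) over the chains C of the proper part, that is the
    h-polynomial of its order complex ([open_hpoly_rec], [chow_functionE]).  In
    the examples below it is written as the sum of g_j X^j (X + 1)^(d - 2 j)
    with g_0 = 1, and a large g_1 g_3 compared to g_2 ^ 2 makes h_1 h_3 exceed
    h_2 ^ 2.

    Such polynomials come from one operation.  If p < p' is a cover relation,
    replace it by a zigzag p < q' > q < p', where the new elements q and q' have
    the ranks of p and p' and are comparable to exactly the elements that are
    comparable to both p and p', besides their neighbours in the zigzag.  On the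
    order complex this subdivides the edge pp' into three edges, so spheres stay
    spheres, and 2 X times the h-polynomial of the link of pp' is added
    ([hsphere_subdivide], [hpoly_link_subdivide]).  Done n times on the same
    edge it adds 2 n X times that h-polynomial.

    Start with the ordinal sum of eight antichains {x_i, y_i}, i < 8, whose
    polynomial is (X + 1)^8.  Subdividing each of the three edges x_0 x_1,
    x_2 x_3, x_4 x_5 of one chain n times contributes
    g_1 = 3 b, g_2 = 3 b^2, g_3 = b^3 with b = 2 n.  To increase g_1 alone one
    needs a further edge that spans no simplex with any of these three, so that
    neither link sees the other subdivisions.  The ordinal sum has none, because
    each end of an edge is incomparable to one element only.  But after one
    subdivision of x_1 y_2 and one of y_3 x_4 the edge y_2 y_3 is such an edge:
    y_2 is no longer comparable to x_1, nor y_3 to x_4.  Subdividing it k times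
    adds 2 k to g_1.  The two single subdivisions change the other terms only
    by lower powers of b.  For n = 50 and k = 500 one gets g_1 = 1304,
    g_2 = 30404, g_3 = 1000000, and then h_1 = 1312, h_2 = 38256, h_3 = 1141232
    violate log-concavity.

    The homological part uses graphs on a fixed finite type in place of posets:
    the order complex is the complex of cliques of the comparability graph.  The
    boundary is a sum of anticommuting operators [del x], which together with
    the operators [ins x] turn the topological steps (removing a vertex with
    acyclic link, replacing a vertex, pushing chains off an edge) into short
    identities between chains.  A clique complex is called spherical if it has
    the homological, dimension and Euler characteristic properties of a sphere,
    and an [hsphere] if this holds for all iterated links.  Intervals of the
    poset are links of chains, so [hsphere] yields both halves of
    Gorenstein* ([bounded_posetP]).

    Failure of real-rootedness follows from failure of log-concavity: a
    polynomial with real nonpositive roots is a constant times a product of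
    factors X + y with y >= 0, and multiplying by such a factor preserves a
    strong form of log-concavity ([real_rooted_log_concave]). *)

(** * Insertion and deletion of a vertex in chains *)
Section ChainOperators.
Variable T : finType.
Implicit Types (x y z : T) (A B : {set T}) (c e : {ffun {set T} -> rat}).

(** [ins x] is the join with the vertex x and [del x] the part of the boundary
    that deletes x.  With these signs they satisfy the relations of fermionic
    creation and annihilation operators ([del_del], [del_ins], [del_insC]). *)
Definition ins x c : {ffun {set T} -> rat} :=
  [ffun A : {set T} => if x \in A then incidence_sign A x * c (A :\ x) else 0].

Definition del x c : {ffun {set T} -> rat} :=
  [ffun A : {set T} =>
     if x \in A then 0 else incidence_sign (x |: A) x * c (x |: A)].

Lemma ins_is_zmod_morphism x : zmod_morphism (ins x).
Proof.
move=> c e; apply/ffunP => A; rewrite !ffunE; case: ifP => _; last by rewrite subr0.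
by rewrite mulrBr.
Qed.
HB.instance Definition _ x := GRing.isZmodMorphism.Build _ _ (ins x)
  (ins_is_zmod_morphism x).

Lemma del_is_zmod_morphism x : zmod_morphism (del x).
Proof.
move=> c e; apply/ffunP => A; rewrite !ffunE; case: ifP => _; first by rewrite subr0.
by rewrite mulrBr.
Qed.
HB.instance Definition _ x := GRing.isZmodMorphism.Build _ _ (del x)
  (del_is_zmod_morphism x).

Lemma boundaryE c : boundary c = \sum_x del x c.
Proof.
apply/ffunP => B; rewrite sum_ffunE ffunE pair_big_dep /=.
rewrite (reindex_onto (fun x => (x |: B, x)) snd) /=; last first.
  by move=> [A x] /= /andP[xA /eqP <-]; rewrite setD1K.
rewrite big_mkcond; apply: eq_bigr => x _; rewrite !ffunE setU11 eqxx andbT /=.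
case: (boolP (x \in B)) => xB.
  rewrite ifF //; apply: contraTF xB => /eqP <-.
  by rewrite !inE eqxx.
by rewrite setU1K // eqxx.
Qed.

Fact boundary_is_zmod_morphism : zmod_morphism (@boundary T).
Proof.
move=> c e; rewrite !boundaryE -sumrB.
by apply: eq_bigr => x _; rewrite raddfB.
Qed.
HB.instance Definition _ := GRing.isZmodMorphism.Build _ _ (@boundary T)
  boundary_is_zmod_morphism.

Lemma incidence_signU1 x y A : y \notin A ->
  incidence_sign (y |: A) x
    = (-1) ^+ (enum_rank y < enum_rank x)%N * incidence_sign A x.
Proof.
move=> yA; rewrite /incidence_sign -exprD; congr (_ ^+ _).
rewrite (cardsD1 y) !inE eqxx /=; congr (_ + _)%N.
by apply: eq_card => z; rewrite !inE; case: eqVneq => //= ->; rewrite (negbTE yA).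
Qed.

Lemma incidence_signU1_self x A : x \notin A ->
  incidence_sign (x |: A) x = incidence_sign A x.
Proof. by move=> xA; rewrite incidence_signU1 // ltnn expr0 mul1r. Qed.

Lemma incidence_sign_sq A x : incidence_sign A x * incidence_sign A x = 1.
Proof. by rewrite /incidence_sign -exprMn mulrNN mulr1 expr1n. Qed.

Lemma rank_signN x y : x != y ->
  (-1) ^+ (enum_rank y < enum_rank x)%N = - (-1) ^+ (enum_rank x < enum_rank y)%N :> rat.
Proof.
move=> xy; have := xy; rewrite -(inj_eq enum_rank_inj) neq_ltn.
by case: ltngtP => //=; rewrite ?expr0 ?expr1 ?opprK.
Qed.

Lemma del_del x y c : del x (del y c) = - del y (del x c).
Proof.
apply/ffunP => A; rewrite !ffunE !inE.
case: (eqVneq x y) => [->|xy] /=; first by rewrite mulr0 if_same oppr0.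
case: ifP => xA; case: ifP => yA; rewrite ?mulr0 ?oppr0 //.
rewrite [y |: (x |: A)]setUCA !incidence_signU1_self ?inE ?negb_or ?xA ?yA ?xy //.
  rewrite (incidence_signU1 x) ?yA // (incidence_signU1 y) ?xA //.
  by rewrite incidence_signU1_self ?yA // (rank_signN xy); ring.
by rewrite !inE negb_or xy xA.
Qed.

Lemma del_ins x c : del x (ins x c) + ins x (del x c) = c.
Proof.
apply/ffunP => A; rewrite !ffunE !inE eqxx /=.
case: (boolP (x \in A)) => xA.
  by rewrite setD1K // add0r mulrA incidence_sign_sq mul1r.
by rewrite setU1K // mulrA incidence_sign_sq mul1r addr0.
Qed.

Lemma del_insC x y c : x != y -> del x (ins y c) = - ins y (del x c).
Proof.
move=> xy; apply/ffunP => A; rewrite !ffunE !inE.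
rewrite [y == x]eq_sym (negbTE xy) /=.
case: (boolP (x \in A)) => xA; case: (boolP (y \in A)) => yA;
  rewrite ?mulr0 ?oppr0 //.
have [B yB AE] : exists2 B : {set T}, y \notin B & A = y |: B.
  by exists (A :\ y); rewrite ?setD11 ?setD1K.
move: xA; rewrite {}AE {A yA} !inE negb_or xy /= => xB.
have yxB : y \notin x |: B by rewrite !inE negb_or eq_sym xy yB.
have xyB : x \notin y |: B by rewrite !inE negb_or xy xB.
have e_x : incidence_sign (x |: (y |: B)) x
    = (-1) ^+ (enum_rank y < enum_rank x)%N * incidence_sign B x.
  by rewrite incidence_signU1_self // incidence_signU1.
have e_y : incidence_sign (x |: (y |: B)) y
    = (-1) ^+ (enum_rank x < enum_rank y)%N * incidence_sign B y.
  by rewrite setUCA incidence_signU1_self // incidence_signU1.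
have e_D : (x |: (y |: B)) :\ y = x |: B by rewrite setUCA setU1K.
rewrite e_x e_y e_D setU1K // !incidence_signU1_self // (rank_signN xy).
have := signrMK (enum_rank x < enum_rank y)%N (1 : rat); rewrite mulr1.
by move: ((-1) ^+ _) => s ss; ring: ss.
Qed.

Lemma boundary_del x c : boundary (del x c) = - del x (boundary c).
Proof.
rewrite !boundaryE raddf_sum -sumrN; apply: eq_bigr => y _.
by rewrite del_del.
Qed.

(** The cone over c with apex x is bounded by c and the cone over the boundary
    of c.  All homotopies below are built from this identity. *)
Lemma boundary_ins x c : boundary (ins x c) = c - ins x (boundary c).
Proof.
rewrite !boundaryE raddf_sum (bigD1 x) //= [in RHS](bigD1 x) //=.
rewrite opprD addrA -[X in X - ins _ _](del_ins x c) addrK; congr (_ + _).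
rewrite -sumrN; apply: eq_bigr => y yx; exact: del_insC.
Qed.

End ChainOperators.

(** * Acyclicity of clique complexes *)
Section Cliques.
Variable T : finType.
Implicit Types (E : rel T) (x y z : T) (A B J : {set T}).
Implicit Types c e : {ffun {set T} -> rat}.

(** The clique complex of a graph on J, rather than an arbitrary simplicial
    complex, because order complexes are of this kind and because the link of a
    vertex x in it is again a clique complex, that of [nbh E J x]. *)
Definition clique E J A : bool :=
  (A \subset J) && [forall x in A, forall y in A, (x != y) ==> E x y].

Definition nbh E J x : {set T} := [set y in J | E x y].

Lemma cliqueP E J A :
  reflect ({subset A <= J} /\ {in A &, forall x y, x != y -> E x y}) (clique E J A).
Proof.
apply: (iffP andP) => [[/subsetP sAJ /forall_inP h]|[sAJ h]]; split=> //.
- by move=> x y xA yA; apply/implyP; apply: (forall_inP (h x xA)).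
- exact/subsetP.
- by apply/forall_inP => x xA; apply/forall_inP => y yA; apply/implyP; exact: h.
Qed.

Lemma eq_clique E E' J A : {in J &, E =2 E'} -> clique E J A = clique E' J A.
Proof.
move=> eqE; apply/cliqueP/cliqueP => -[sAJ h]; split=> // x y xA yA xy.
  by rewrite -eqE ?h ?sAJ.
by rewrite eqE ?h ?sAJ.
Qed.

Lemma eq_nbh E E' J x : x \in J -> {in J &, E =2 E'} -> nbh E J x = nbh E' J x.
Proof.
move=> xJ eqE; apply/setP => y; rewrite !inE; case: (boolP (y \in J)) => //= yJ.
exact: eqE.
Qed.

Lemma clique0 E J : clique E J set0.
Proof. by apply/cliqueP; split=> x; rewrite inE. Qed.

Lemma cliqueD1 E J x A : clique E (J :\ x) A = clique E J A && (x \notin A).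
Proof.
apply/cliqueP/andP => [[sA h]|[/cliqueP[sA h] xA]].
  split; last by apply/negP => /sA; rewrite !inE eqxx.
  by apply/cliqueP; split=> // y /sA; rewrite inE => /andP[].
split=> // y yA; rewrite !inE sA // andbT.
by apply: contraNneq xA => <-.
Qed.

Lemma cliqueU1 E J x B : symmetric E -> x \notin B ->
  clique E J (x |: B) = (x \in J) && clique E (nbh E J x) B.
Proof.
move=> symE xB; apply/cliqueP/andP => [[sA h]|[xJ /cliqueP[sA h]]].
  split; first by rewrite sA ?setU11.
  apply/cliqueP; split=> [y yB|y z yB zB]; last by apply: h; rewrite !inE ?yB ?zB orbT.
  rewrite inE sA ?inE ?yB ?orbT //= h ?inE ?eqxx ?yB ?orbT //.
  by apply: contraNneq xB => ->.
split=> [y|y z]; first by case/setU1P => [->//|/sA]; rewrite inE => /andP[].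
case/setU1P => [->|yB]; case/setU1P => [->|zB] yz.
- by rewrite eqxx in yz.
- by have := sA z zB; rewrite inE => /andP[].
- by rewrite symE; have := sA y yB; rewrite inE => /andP[].
- exact: h.
Qed.

Lemma clique_sub E J J' A : J \subset J' -> clique E J A -> clique E J' A.
Proof.
by move=> sJ /cliqueP[sA h]; apply/cliqueP; split=> // x /sA; exact: (subsetP sJ).
Qed.

(** Here n counts vertices: such a c is a chain of dimension n - 1. *)
Definition chain_on E J n c : Prop :=
  forall A, c A != 0 -> clique E J A /\ #|A| = n.

(** Reduced homology vanishes in all dimensions below m - 1. *)
Definition acyclic E J m : Prop :=
  forall n, (n < m)%N -> forall c, chain_on E J n c -> boundary c = 0 ->
  exists2 e, chain_on E J n.+1 e & boundary e = c.

Lemma chain_onD E J n c e : chain_on E J n c -> chain_on E J n e ->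
  chain_on E J n (c + e).
Proof.
move=> hc he A; rewrite ffunE; case: (eqVneq (c A) 0) => [->|/hc//].
by rewrite add0r => /he.
Qed.

Lemma chain_onN E J n c : chain_on E J n c -> chain_on E J n (- c).
Proof. by move=> hc A; rewrite ffunE oppr_eq0 => /hc. Qed.

Lemma chain_onB E J n c e : chain_on E J n c -> chain_on E J n e ->
  chain_on E J n (c - e).
Proof. by move=> hc he; apply: chain_onD => //; exact: chain_onN. Qed.

Lemma chain_on_sub E J J' n c : J \subset J' -> chain_on E J n c -> chain_on E J' n c.
Proof. by move=> sJ hc A /hc[hA ?]; split=> //; apply: clique_sub hA. Qed.

Lemma eq_chain_on E E' J n c : {in J &, E =2 E'} -> chain_on E J n c -> chain_on E' J n c.
Proof. by move=> eqE hc A /hc[]; rewrite (eq_clique _ eqE). Qed.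

Lemma eq_acyclic E E' J m : {in J &, E =2 E'} -> acyclic E J m -> acyclic E' J m.
Proof.
move=> eqE hJ n lt_nm c hc bc.
have eqE' : {in J &, E' =2 E} by move=> x y xJ yJ; rewrite eqE.
have [e he be] := hJ n lt_nm c (eq_chain_on eqE' hc) bc.
by exists e => //; apply: eq_chain_on he.
Qed.

Lemma del_chain E J n x c : symmetric E ->
  chain_on E J n.+1 c -> chain_on E (nbh E J x) n (del x c).
Proof.
move=> symE hc A; rewrite ffunE; case: (boolP (x \in A)) => xA; first by rewrite eqxx.
rewrite mulf_eq0 negb_or => /andP[_ /hc[]]; rewrite cliqueU1 // cardsU1 xA.
by case/andP => _ hA [<-].
Qed.

Lemma del_chain0 E J x c : chain_on E J 0 c -> del x c = 0.
Proof.
move=> hc; apply/ffunP => A; rewrite !ffunE; case: ifP => // xA.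
case: (eqVneq (c (x |: A)) 0) => [->|/hc[_ /eqP]]; first by rewrite mulr0.
by rewrite cards_eq0 => /eqP/setP/(_ x); rewrite !inE eqxx.
Qed.

Lemma ins_chain E J n x c : symmetric E -> x \in J ->
  chain_on E (nbh E J x) n c -> chain_on E J n.+1 (ins x c).
Proof.
move=> symE xJ hc A; rewrite ffunE; case: (boolP (x \in A)) => xA; last by rewrite eqxx.
rewrite mulf_eq0 negb_or => /andP[_ /hc[hA sA]].
rewrite -(setD1K xA) cliqueU1 ?setD11 // xJ hA; split=> //.
by rewrite cardsU1 setD11 sA.
Qed.

Lemma del_ins_chain E J n x c :
  chain_on E J n c -> chain_on E (J :\ x) n (del x (ins x c)).
Proof.
move=> hc A; rewrite !ffunE; case: (boolP (x \in A)) => xA; first by rewrite eqxx.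
rewrite setU11 setU1K // mulrA incidence_sign_sq mul1r => /hc[hA ?].
by rewrite cliqueD1 hA xA.
Qed.

Lemma acyclic0 E J : acyclic E J 0.
Proof. by []. Qed.

Lemma nbh_subD1 E J x : irreflexive E -> nbh E J x \subset J :\ x.
Proof.
move=> irrE; apply/subsetP => y; rewrite !inE => /andP[-> Exy]; rewrite andbT.
by apply: contraTneq Exy => ->; rewrite irrE.
Qed.

(** Mayer-Vietoris for the star of x.  If c is a cycle, then [del x c] is a cycle
    of the link of x, say the boundary of b; adding the boundary of [ins x b] to
    c gives a cycle that avoids x. *)
Lemma acyclic_vertex E J x m : symmetric E -> irreflexive E -> x \in J ->
  acyclic E (J :\ x) m.+1 -> acyclic E (nbh E J x) m -> acyclic E J m.+1.
Proof.
move=> symE irrE xJ hD hN [|n] lt_nm c hc bc.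
  have hc' : chain_on E (J :\ x) 0 c.
    by rewrite -(del_ins x c) (del_chain0 _ hc) raddf0 addr0; exact: del_ins_chain.
  have [e he be] := hD 0 lt_nm c hc' bc.
  by exists e => //; apply: chain_on_sub he; exact: subD1set.
have ha := del_chain (x := x) symE hc.
have [||b hb bb] := hN n _ _ ha; first exact: lt_nm.
  by rewrite boundary_del bc raddf0 oppr0.
have hc' : chain_on E (J :\ x) n.+1 (del x (ins x c) + b).
  apply: chain_onD; first exact: del_ins_chain.
  by apply: chain_on_sub hb; exact: nbh_subD1.
have bi : boundary (ins x b) = b - ins x (del x c) by rewrite boundary_ins bb.
have cE : del x (ins x c) + b = c + boundary (ins x b).
  by rewrite bi -{2}(del_ins x c) [b - _]addrC addrA addrK.
have [|e he be] := hD _ lt_nm _ hc'.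
  rewrite cE raddfD /= bc add0r bi raddfB /= boundary_ins.
  by rewrite bb boundary_del bc !raddf0 addr0 subrr.
exists (e - ins x b); last by rewrite raddfB /= be cE addrK.
apply: chain_onB; first by apply: chain_on_sub he; exact: subD1set.
exact: ins_chain.
Qed.

(** A cycle c is the boundary of [ins x c]. *)
Lemma acyclic_cone E J x m : symmetric E -> x \in J ->
  (forall y, y \in J -> y != x -> E x y) -> acyclic E J m.
Proof.
move=> symE xJ hx n _ c hc bc; exists (ins x c); last first.
  by rewrite boundary_ins bc raddf0 subr0.
move=> A; rewrite ffunE; case: (boolP (x \in A)) => xA; last by rewrite eqxx.
rewrite mulf_eq0 negb_or => /andP[_ /hc[/cliqueP[sA h] cA]].
split; last by rewrite -cA (cardsD1 x A) xA.
rewrite -(setD1K xA) cliqueU1 ?setD11 // xJ; apply/cliqueP; split=> // y yA.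
rewrite inE sA //= hx ?sA //.
by move: yA; rewrite !inE => /andP[].
Qed.
End Cliques.

(** * Replacing a vertex and removing an edge *)
Section Moves.
Variable T : finType.
Implicit Types (E : rel T) (x y z : T) (A B J : {set T}).
Implicit Types c e : {ffun {set T} -> rat}.

(** The chain map induced by sending the vertex a to b: the first summand is the
    part of c that avoids a. *)
Definition replace_vertex a b c := del a (ins a c) + ins b (del a c).

Lemma boundary_replace_vertex a b c : boundary (replace_vertex a b c) = replace_vertex a
    b (boundary c).
Proof.
rewrite /replace_vertex raddfD /= boundary_del !boundary_ins boundary_del !raddfB /=
    !raddfN /=.
by rewrite !opprK addrACA addNr add0r.
Qed.

Lemma del_avoid E J n x c : chain_on E J n c -> x \notin J -> del x c = 0.
Proof.
move=> hc xJ; apply/ffunP => A; rewrite !ffunE; case: ifP => // xA.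
case: (eqVneq (c (x |: A)) 0) => [->|/hc[/cliqueP[sA _] _]]; first by rewrite mulr0.
by rewrite sA ?setU11 in xJ.
Qed.

Lemma nbhU1 E J x y : nbh E (y |: J) x = if E x y then y |: nbh E J x else nbh E J x.
Proof.
apply/setP => z; case: ifP => Exy; rewrite !inE; case: eqVneq => //= ->.
by rewrite Exy.
by rewrite Exy andbF.
Qed.

Lemma replace_vertex_chain E E' J a b n c :
    symmetric E -> symmetric E' -> irreflexive E -> irreflexive E' ->
    a \notin J -> {in J &, E =2 E'} -> {in J, E a =1 E' b} ->
  chain_on E (a |: J) n c -> chain_on E' (b |: J) n (replace_vertex a b c).
Proof.
move=> symE symE' irrE irrE' aJ eqE eqab hc; apply: chain_onD.
  apply: chain_on_sub (subsetUr _ _) _; apply: eq_chain_on eqE _.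
  by rewrite -(setU1K aJ); exact: del_ins_chain.
case: n hc => [|n] hc.
  by rewrite (del_chain0 _ hc) raddf0 => A; rewrite ffunE eqxx.
apply: ins_chain; rewrite ?setU11 // nbhU1 irrE'.
have := del_chain (x := a) symE hc; rewrite nbhU1 irrE.
have -> : nbh E J a = nbh E' J b.
  by apply/setP => y; rewrite !inE; case: (boolP (y \in J)) => //= /eqab ->.
by apply: eq_chain_on => x y; rewrite !inE => /andP[xJ _] /andP[yJ _]; exact: eqE.
Qed.

Lemma replace_vertexK E J a b n c : a \notin J -> b \notin J -> a != b ->
  chain_on E (a |: J) n c -> replace_vertex b a (replace_vertex a b c) = c.
Proof.
move=> aJ bJ ab hc.
have b0 : del b c = 0.
  by apply: del_avoid hc _; rewrite !inE negb_or eq_sym ab.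
have bw : del b (del a c) = 0 by rewrite del_del b0 !raddf0.
have bu : del b (del a (ins a c)) = 0.
  by rewrite del_del del_insC 1?eq_sym // b0 !raddf0.
have bs : del b (replace_vertex a b c) = del a c.
  rewrite /replace_vertex raddfD /= bu add0r.
  by have := del_ins b (del a c); rewrite bw raddf0 addr0.
have ub : del b (ins b (replace_vertex a b c)) = del a (ins a c).
  by have := del_ins b (replace_vertex a b c); rewrite bs [RHS]/replace_vertex => /addIr.
by rewrite [LHS]/replace_vertex ub bs; exact: del_ins.
Qed.

(** Acyclicity is invariant under renaming a vertex.  This needs a proof, because
    renaming changes the orientations, which come from the enumeration of T. *)
Lemma acyclic_rename E E' J a b m :
    symmetric E -> symmetric E' -> irreflexive E -> irreflexive E' ->
    a \notin J -> b \notin J -> a != b ->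
    {in J &, E =2 E'} -> {in J, E a =1 E' b} ->
  acyclic E (a |: J) m -> acyclic E' (b |: J) m.
Proof.
move=> symE symE' irrE irrE' aJ bJ ab eqE eqab hJ n lt_nm c hc bc.
have eqE' : {in J &, E' =2 E} by move=> x y xJ yJ; rewrite eqE.
have eqba : {in J, E' b =1 E a} by move=> x xJ; rewrite eqab.
have hs : chain_on E (a |: J) n (replace_vertex b a c) by apply: replace_vertex_chain hc.
have [|e he be] := hJ n lt_nm _ hs;
    first by rewrite boundary_replace_vertex bc /replace_vertex !raddf0 addr0.
exists (replace_vertex a b e); first exact: replace_vertex_chain he.
by rewrite boundary_replace_vertex be; apply: replace_vertexK hc; rewrite // eq_sym.
Qed.

Definition add_edge E a b : rel T :=
  fun x y => [|| E x y, (x == a) && (y == b) | (x == b) && (y == a)].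

Lemma add_edge_sym E a b : symmetric E -> symmetric (add_edge E a b).
Proof.
move=> symE x y; rewrite /add_edge symE; congr (_ || _).
by rewrite orbC ![(x == _) && _]andbC.
Qed.

Lemma add_edge_irr E a b : irreflexive E -> a != b -> irreflexive (add_edge E a b).
Proof.
move=> irrE ab x; rewrite /add_edge irrE /=; apply/norP; split; apply: contraNN ab.
  by case/andP => /eqP <-.
by case/andP => /eqP <- /eqP <-.
Qed.

(** The join with the 0-cycle a - b. *)
Definition join_pair a b c := ins a c - ins b c.

Lemma boundary_join_pair a b c : boundary (join_pair a b c) = - join_pair a b (boundary c).
Proof.
by rewrite /join_pair raddfB /= !boundary_ins !opprB addrC addrA addrNK.
Qed.

Lemma join_pair0 a b : join_pair a b 0 = 0.
Proof. by rewrite /join_pair !raddf0 addr0. Qed.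

Lemma del_join_pair_avoid x a b c : x != a -> x != b -> del x c = 0 ->
  del x (join_pair a b c) = 0.
Proof.
by move=> xa xb xc; rewrite /join_pair raddfB /= !del_insC // xc !raddf0 addr0.
Qed.

Lemma del_join_pair a b c : a != b -> del a c = 0 -> del a (join_pair a b c) = c.
Proof.
move=> ab ac; rewrite /join_pair raddfB /= (del_insC _ ab) ac !raddf0 addr0.
by have := del_ins a c; rewrite ac raddf0 addr0.
Qed.

Lemma join_pair_chain E J J' n a b c : symmetric E -> a \in J -> b \in J ->
    J' \subset nbh E J a -> J' \subset nbh E J b ->
  chain_on E J' n c -> chain_on E J n.+1 (join_pair a b c).
Proof.
move=> symE aJ bJ sa sb hc; apply: chain_onB; apply: ins_chain => //.
  exact: chain_on_sub hc.
exact: chain_on_sub hc.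
Qed.

(** Suppose that every common neighbour of p and p' is adjacent to q and q', and
    that p q' q p' is a path.  In the graph with the edge pp' added, subtracting
    from a chain b the join of its coefficient z at pp' with the 4-cycle
    p p' q q' removes the simplices that contain pp'.  The boundary does not
    change if that of b already avoids pp', since then z is a cycle. *)
Lemma acyclic_cut_edge E J m p p' q q' :
    symmetric E -> irreflexive E -> uniq [:: p; p'; q; q'] ->
    {subset [:: p; p'; q; q'] <= J} ->
    ~~ E p q -> ~~ E p' q' -> ~~ E p p' -> E q q' -> E q p' -> E p q' ->
    {in J, forall y, E p y -> E p' y -> E q y && E q' y} ->
  acyclic (add_edge E p p') J m -> acyclic E J m.
Proof.
move=> symE irrE Upq sJ Epq Ep'q' Epp' Eqq' Eqp' Epq' hL hJ n lt_nm c hc bc.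
have [pJ p'J qJ q'J] : [/\ p \in J, p' \in J, q \in J & q' \in J].
  by split; apply: sJ; rewrite !inE eqxx ?orbT.
move: Upq; rewrite /= !inE !negb_or andbT => /and3P[/and3P[pp' pq pq'] /andP[p'q p'q'] qq'].
pose E2 := add_edge E p p'.
have symE2 : symmetric E2 by exact: add_edge_sym.
have irrE2 : irreflexive E2 by exact: add_edge_irr.
have sub2 x y : E x y -> E2 x y by rewrite /E2 /add_edge => ->.
have hc2 : chain_on E2 J n c.
  move=> A /hc[/cliqueP[sA h] cA]; split=> //; apply/cliqueP; split=> // x y xA yA xy.
  by rewrite sub2 ?h.
have [b hb bb] := hJ n lt_nm c hc2 bc.
have nE2 A : p \in A -> p' \in A -> ~~ clique E J A.
  move=> pA p'A; apply: contra Epp' => /cliqueP[_ h]; exact: h.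
have delc : del p' (del p c) = 0.
  apply/ffunP => A; rewrite !ffunE; case: ifP => // p'A.
  case: ifP; rewrite ?mulr0 // => pA.
  case: (eqVneq (c (p |: (p' |: A))) 0) => [->|/hc[hA _]]; first by rewrite !mulr0.
  by have := nE2 (p |: (p' |: A)); rewrite hA !inE !eqxx orbT => /(_ isT isT).
(* The coefficient of b at the edge pp'. *)
pose z := del p' (del p b).
pose K := nbh E2 (nbh E2 J p) p'.
have hz0 : z = 0 \/ exists2 n', n = n'.+1 & chain_on E2 K n' z.
  case: n {lt_nm hc bc hc2} hb => [|n'] hb.
    left; apply: (@del_chain0 _ E2 (nbh E2 J p)); exact: del_chain.
  by right; exists n' => //; apply: del_chain => //; apply: del_chain.
(* The join of z with the 4-cycle is (p - q) * (p' - q') * z. *)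
pose w := join_pair p' q' z; pose d := join_pair p q w.
have bz : boundary z = 0 by rewrite /z !boundary_del bb raddfN /= opprK delc.
have bd : boundary d = 0.
  by rewrite /d boundary_join_pair /w boundary_join_pair bz join_pair0 oppr0 join_pair0
      oppr0.
have del_z : del p z = 0 /\ del p' z = 0.
  have dd x e : del x (del x e) = 0.
    by apply/ffunP => A; rewrite !ffunE; case: ifP => // _; rewrite setU11 mulr0.
  by rewrite /z; split; rewrite ?dd // del_del dd !raddf0.
case: del_z => dpz dp'z.
have pw : del p w = 0 by apply: del_join_pair_avoid.
have dd : del p' (del p (b - d)) = 0.
  have -> : del p (b - d) = del p b - w by rewrite raddfB /= del_join_pair.
  by rewrite raddfB /= del_join_pair // subrr.
have hd : chain_on E2 J n.+1 d.
  case: hz0 => [z0|[n' def_n hz]].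
    by move=> A; rewrite /d /w z0 !join_pair0 ffunE eqxx.
  have subK y : y \in K -> [/\ y \in J, E p y, E p' y, E2 q y & E2 q' y].
    rewrite !inE => /andP[/andP[yJ E2py] E2p'y].
    have yp : y != p by apply: contraTneq E2py => ->; rewrite irrE2.
    have yp' : y != p' by apply: contraTneq E2p'y => ->; rewrite irrE2.
    have Epy : E p y.
      by move: E2py; rewrite /E2 /add_edge (negbTE yp) (negbTE yp') !andbF !orbF.
    have Ep'y : E p' y.
      by move: E2p'y; rewrite /E2 /add_edge (negbTE yp) (negbTE yp') !andbF !orbF.
    by have /andP[? ?] := hL y yJ Epy Ep'y; split=> //; exact: sub2.
  have E2pp' : E2 p p' by rewrite /E2 /add_edge !eqxx /= orbT.
  rewrite def_n; apply: (@join_pair_chain E2 J (nbh E2 J p :&: nbh E2 J q)) => //;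
      rewrite ?subsetIl ?subsetIr //.
  apply: (@join_pair_chain E2 _ K) => //.
  - by rewrite !inE p'J E2pp' sub2.
  - by rewrite !inE q'J !sub2.
  - apply/subsetP => y /subK[yJ Epy Ep'y E2qy E2q'y].
    by rewrite !inE yJ E2qy !sub2.
  - apply/subsetP => y /subK[yJ Epy Ep'y E2qy E2q'y].
    by rewrite !inE yJ E2qy E2q'y sub2.
exists (b - d); last by rewrite raddfB /= bb bd subr0.
move=> A eA; have [hA cA] := chain_onB hb hd eA; split=> //.
have npp' : ~~ ((p \in A) && (p' \in A)).
  apply/negP => /andP[pA p'A]; move: dd => /ffunP/(_ (A :\ p :\ p')).
  have p'A' : p' \in A :\ p by rewrite !inE p'A eq_sym pp'.
  rewrite [LHS]ffunE setD11 setD1K // [X in _ * X]ffunE setD11 setD1K // [RHS]ffunE.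
  by move/eqP; rewrite !mulf_eq0 /incidence_sign !signr_eq0 (negbTE eA).
case/cliqueP: hA => sA h; apply/cliqueP; split=> // x y xA yA xy.
have := h x y xA yA xy; rewrite /E2 /add_edge; case/or3P=> //.
  by case/andP => /eqP xp /eqP yp; move: npp'; rewrite -xp -yp xA yA.
by case/andP => /eqP xp /eqP yp; move: npp'; rewrite -xp -yp xA yA.
Qed.
End Moves.

(** * Spherical clique complexes *)
Section Spheres.
Variable T : finType.
Implicit Types (E : rel T) (x y z : T) (A B J : {set T}).

Definition bounded E J m : Prop := forall A, clique E J A -> (#|A| <= m)%N.

(** For a complex of dimension m - 1 this is the h-polynomial, read backwards;
    the two readings agree for spheres, by the Dehn-Sommerville equations. *)
Definition hpoly E J m : {poly int} :=
  \sum_(A : {set T} | clique E J A) ('X - 1) ^+ (m - #|A|).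

Lemma eq_bounded E E' J m : {in J &, E =2 E'} -> bounded E J m -> bounded E' J m.
Proof. by move=> eqE h A; rewrite -(eq_clique _ eqE); exact: h. Qed.

Lemma eq_hpoly E E' J m : {in J &, E =2 E'} -> hpoly E J m = hpoly E' J m.
Proof. by move=> eqE; apply: eq_bigl => A; exact: eq_clique. Qed.

Lemma bounded_vertex E J x m : symmetric E ->
  bounded E (J :\ x) m.+1 -> bounded E (nbh E J x) m -> bounded E J m.+1.
Proof.
move=> symE hD hN A hA; case: (boolP (x \in A)) => xA; last first.
  by apply: hD; rewrite cliqueD1 hA.
move: hA; rewrite -(setD1K xA) cliqueU1 ?setD11 // => /andP[_ /hN].
by rewrite cardsU1 setD11.
Qed.

(** The cliques that contain x correspond to those of its neighbourhood. *)
Lemma hpoly_vertex E J x m : symmetric E -> irreflexive E -> x \in J ->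
  hpoly E J m.+1 = hpoly E (J :\ x) m.+1 + hpoly E (nbh E J x) m.
Proof.
move=> symE irrE xJ; rewrite /hpoly (bigID (fun A => x \in A)) /= addrC; congr (_ + _).
  by apply: eq_bigl => A; rewrite cliqueD1.
rewrite (reindex_onto (fun B => x |: B) (fun A => A :\ x)) /=; last first.
  by move=> A /andP[_ xA]; rewrite setD1K.
have eqB B : ((x |: B) :\ x == B) = (x \notin B).
  by apply/eqP/idP => [<-|/setU1K //]; rewrite setD11.
apply: eq_big => [B|B]; rewrite setU11 andbT eqB; last first.
  by case/andP => _ xB; rewrite cardsU1 xB subSS.
case: (boolP (x \in B)) => xB; last by rewrite cliqueU1 // xJ andbT.
rewrite andbF; apply/esym/negbTE/negP => /cliqueP[/(_ x xB)].
by rewrite inE irrE andbF.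
Qed.

Lemma hpolyS E J m : bounded E J m -> hpoly E J m.+1 = ('X - 1) * hpoly E J m.
Proof.
move=> hb; rewrite /hpoly mulr_sumr; apply: eq_bigr => A hA.
by rewrite subSn ?hb // exprS.
Qed.

Lemma bounded0 E J x : bounded E J 0 -> x \in J -> False.
Proof.
move=> hb xJ; suff /hb: clique E J [set x] by rewrite cards1.
apply/cliqueP; split=> [y|y z]; rewrite !inE => /eqP-> //.
by move=> /eqP-> ; rewrite eqxx.
Qed.

Lemma boundedS E J m : bounded E J m -> bounded E J m.+1.
Proof. by move=> h A /h /leqW. Qed.

(** The condition on [hpoly] is on the Euler characteristic: its constant
    coefficient is the sum of (-1)^(m - |A|) over the cliques A. *)
Record spherical E J m : Prop := Spherical {
  spherical_bounded : bounded E J m;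
  spherical_acyclic : acyclic E J m;
  spherical_hpoly0 : (hpoly E J m)`_0 = 1 }.

Lemma eq_spherical E E' J m : {in J &, E =2 E'} ->
  spherical E J m -> spherical E' J m.
Proof.
move=> eqE [hb ha h0]; split; first exact: eq_bounded eqE hb.
  exact: eq_acyclic eqE ha.
by rewrite -(eq_hpoly _ eqE).
Qed.

Lemma nbh_cone E J x : x \notin J -> irreflexive E -> {in J, forall y,
    E x y} -> nbh E (x |: J) x = J.
Proof.
move=> xJ irrE hx; rewrite nbhU1 irrE; apply/setP => y; rewrite inE.
by case: (boolP (y \in J)) => //= /hx.
Qed.

Section Cone.
Variables (E : rel T) (J : {set T}) (x : T) (m : nat).
Hypotheses (symE : symmetric E) (irrE : irreflexive E) (xJ : x \notin J).
Hypotheses (hx : {in J, forall y, E x y}) (hb : bounded E J m).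

Lemma bounded_cone : bounded E (x |: J) m.+1.
Proof.
apply: (@bounded_vertex _ _ x) => //; first by rewrite setU1K //; exact: boundedS.
by rewrite nbh_cone.
Qed.

Lemma hpoly_cone : hpoly E (x |: J) m.+1 = 'X * hpoly E J m.
Proof.
rewrite (@hpoly_vertex _ _ x) ?setU11 // setU1K // nbh_cone // hpolyS //; ring.
Qed.

Lemma acyclic_coneU1 n : acyclic E (x |: J) n.
Proof.
apply: (@acyclic_cone _ _ _ x); rewrite ?setU11 // => y /setU1P[->|/hx//].
by rewrite eqxx.
Qed.
End Cone.

(** The suspension of J with apices x and y: removing x leaves a cone with apex
    y, and the link of x is J. *)
Section Suspension.
Variables (E : rel T) (J : {set T}) (x y : T) (m : nat).
Hypotheses (symE : symmetric E) (irrE : irreflexive E).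
Hypotheses (xJ : x \notin J) (yJ : y \notin J) (xy : x != y) (Exy : ~~ E x y).
Hypotheses (hx : {in J, forall z, E x z}) (hy : {in J, forall z, E y z}).
Hypothesis hJ : spherical E J m.

Let xyJ : x \notin y |: J.
Proof. by rewrite !inE negb_or xy. Qed.

Let nbh_x : nbh E (x |: (y |: J)) x = J.
Proof.
rewrite nbhU1 irrE nbhU1 (negbTE Exy); apply/setP => z; rewrite inE.
by case: (boolP (z \in J)) => //= /hx.
Qed.

Lemma hpoly_susp : hpoly E (x |: (y |: J)) m.+1 = ('X + 1) * hpoly E J m.
Proof.
rewrite (@hpoly_vertex _ _ x) ?setU11 // nbh_x setU1K //.
by rewrite hpoly_cone //; [ring|case: hJ].
Qed.

Lemma spherical_susp : spherical E (x |: (y |: J)) m.+1.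
Proof.
case: hJ => hb ha h0; split.
- apply: (@bounded_vertex _ _ x) => //; rewrite ?nbh_x // setU1K //.
  exact: bounded_cone.
- apply: (@acyclic_vertex _ _ _ x); rewrite ?setU11 ?nbh_x // setU1K //.
  exact: acyclic_coneU1.
- by rewrite hpoly_susp mulrDl mul1r coefD coefXM /= add0r.
Qed.
End Suspension.

Lemma hpoly_rename E E' J a b m :
    symmetric E -> symmetric E' -> irreflexive E -> irreflexive E' ->
    a \notin J -> b \notin J ->
    {in J &, E =2 E'} -> {in J, E a =1 E' b} ->
  hpoly E (a |: J) m.+1 = hpoly E' (b |: J) m.+1.
Proof.
move=> symE symE' irrE irrE' aJ bJ eqE eqab.
rewrite (@hpoly_vertex _ _ a) ?setU11 // [RHS](@hpoly_vertex _ _ b) ?setU11 //.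
rewrite !setU1K // (eq_hpoly _ eqE); congr (_ + _).
rewrite !nbhU1 irrE irrE'.
have -> : nbh E J a = nbh E' J b.
  by apply/setP => y; rewrite !inE; case: (boolP (y \in J)) => //= /eqab ->.
by apply: eq_hpoly => x y; rewrite !inE => /andP[xJ _] /andP[yJ _]; exact: eqE.
Qed.

Lemma bounded_rename E E' J a b m :
    symmetric E -> symmetric E' -> irreflexive E -> irreflexive E' ->
    a \notin J -> b \notin J ->
    {in J &, E =2 E'} -> {in J, E a =1 E' b} ->
  bounded E (a |: J) m -> bounded E' (b |: J) m.
Proof.
move=> symE symE' irrE irrE' aJ bJ eqE eqab hb A hA.
case: (boolP (b \in A)) => bA; last first.
  have := @cliqueD1 _ E' (b |: J) b A; rewrite hA bA setU1K // -(eq_clique _ eqE) => hA'.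
  by apply: hb; apply: clique_sub hA'; exact: subsetUr.
pose B := A :\ b.
have bB : b \notin B by rewrite setD11.
have AE : A = b |: B by rewrite setD1K.
move: hA; rewrite AE cliqueU1 // nbhU1 irrE' => /andP[_ hB].
have sB : B \subset J by case/cliqueP: hB => sB _; apply/subsetP => y /sB;
    rewrite inE => /andP[].
have aB : a \notin B by apply: contra aJ; exact: (subsetP sB).
have: clique E (a |: J) (a |: B).
  rewrite cliqueU1 // setU11 nbhU1 irrE.
  have -> : nbh E J a = nbh E' J b.
    by apply/setP => y; rewrite !inE; case: (boolP (y \in J)) => //= /eqab ->.
  rewrite (eq_clique (E' := E')) // => x y; rewrite !inE => /andP[xJ _] /andP[yJ _].
  exact: eqE.
by move/hb; rewrite !cardsU1 aB bB.
Qed.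

Lemma spherical_rename E E' J a b m :
    symmetric E -> symmetric E' -> irreflexive E -> irreflexive E' ->
    a \notin J -> b \notin J -> a != b ->
    {in J &, E =2 E'} -> {in J, E a =1 E' b} ->
  spherical E (a |: J) m -> spherical E' (b |: J) m.
Proof.
move=> symE symE' irrE irrE' aJ bJ ab eqE eqab [hb ha h0].
case: m hb ha h0 => [|m] hb ha h0.
  by case: (bounded0 hb (setU11 a J)).
split; first exact: bounded_rename hb.
  exact: acyclic_rename ha.
by rewrite -(@hpoly_rename E E' J a b).
Qed.

(** All iterated links are spherical.  Asking this of vertex links recursively
    rather than of the links of all cliques lets every construction be treated
    by induction on m, looking at one vertex at a time. *)
Fixpoint hsphere E J m : Prop :=
  spherical E J m /\
  if m is m'.+1 then forall x, x \in J -> hsphere E (nbh E J x) m' else True.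

Lemma hsphere_spherical E J m : hsphere E J m -> spherical E J m.
Proof. by case: m => [|m] []. Qed.

Lemma hsphere_nbh E J m x : hsphere E J m -> x \in J -> hsphere E (nbh E J x) m.-1.
Proof.
case: m => [|m] [hs hl] xJ; last exact: hl.
by case: (bounded0 (spherical_bounded hs) xJ).
Qed.

Lemma hsphere_gt0 E J m x : hsphere E J m -> x \in J -> (0 < m)%N.
Proof.
by case: m => // -[hs _] xJ; case: (bounded0 (spherical_bounded hs) xJ).
Qed.

Lemma eq_hsphere E E' J m : {in J &, E =2 E'} -> hsphere E J m -> hsphere E' J m.
Proof.
elim: m J => [|m IHm] J eqE /= [hs hl]; split=> //; try exact: eq_spherical eqE hs.
move=> x xJ; rewrite -(eq_nbh xJ eqE); apply: IHm (hl x xJ) => y z.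
by rewrite !inE => /andP[yJ _] /andP[zJ _]; exact: eqE.
Qed.

Lemma hsphere_susp E J x y m : symmetric E -> irreflexive E ->
    x \notin J -> y \notin J -> x != y -> ~~ E x y ->
    {in J, forall z, E x z} -> {in J, forall z, E y z} ->
  hsphere E J m -> hsphere E (x |: (y |: J)) m.+1.
Proof.
move=> symE irrE; elim: m J => [|m IHm] J xJ yJ xy Exy hx hy hJ.
  have hs := hsphere_spherical hJ.
  split; first exact: spherical_susp.
  move=> z zJ; suff -> : nbh E (x |: (y |: J)) z = J by [].
  have J0 : J = set0.
    by apply/setP => u; rewrite inE; apply/negP => /(bounded0 (spherical_bounded hs)).
  move: zJ; rewrite J0 !inE orbF => zxy; apply/setP => u; rewrite !inE orbF.
  apply/negP => /andP[/orP[]/eqP-> Ezu]; case/orP: zxy Ezu => /eqP->; rewrite ?irrE //.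
    by rewrite symE (negbTE Exy).
  by rewrite (negbTE Exy).
have hs := hsphere_spherical hJ.
split; first exact: spherical_susp.
move=> z; rewrite !inE => /or3P[/eqP->|/eqP->|zJ].
- suff -> : nbh E (x |: (y |: J)) x = J by [].
  rewrite !nbhU1 irrE (negbTE Exy); apply/setP => u; rewrite inE.
  by case: (boolP (u \in J)) => //= /hx.
- suff -> : nbh E (x |: (y |: J)) y = J by [].
  rewrite !nbhU1 irrE symE (negbTE Exy); apply/setP => u; rewrite inE.
  by case: (boolP (u \in J)) => //= /hy.
rewrite !nbhU1 ![E z _]symE hx // hy //; apply: IHm => //;
    rewrite ?inE ?(negbTE xJ) ?(negbTE yJ) //.
- by move=> u; rewrite inE => /andP[/hx].
- by move=> u; rewrite inE => /andP[/hy].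
exact: hsphere_nbh hJ zJ.
Qed.

Lemma hsphere_rename E E' J a b m :
    symmetric E -> symmetric E' -> irreflexive E -> irreflexive E' ->
    a \notin J -> b \notin J -> a != b ->
    {in J &, E =2 E'} -> {in J, E a =1 E' b} ->
  hsphere E (a |: J) m -> hsphere E' (b |: J) m.
Proof.
move=> symE symE' irrE irrE'; elim: m J => [|m IHm] J aJ bJ ab eqE eqab hJ.
  by have := hsphere_gt0 hJ (setU11 a J).
have hs := hsphere_spherical hJ.
split; first exact: spherical_rename hs.
have eqN z : z \in J -> {in nbh E J z &, E =2 E'}.
  by move=> zJ x y; rewrite !inE => /andP[xJ _] /andP[yJ _]; exact: eqE.
move=> z /setU1P[->|zJ].
  have := hsphere_nbh hJ (setU11 a J); rewrite !nbhU1 irrE irrE'.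
  have -> : nbh E J a = nbh E' J b.
    by apply/setP => y; rewrite !inE; case: (boolP (y \in J)) => //= /eqab ->.
  by apply: eq_hsphere => x y; rewrite !inE => /andP[xJ _] /andP[yJ _]; exact: eqE.
have := hsphere_nbh hJ (setU1r a zJ); rewrite !nbhU1 [E z a]symE eqab // [E' b z]symE' /=.
rewrite -(eq_nbh zJ eqE); case: ifP => Ezb; last exact: eq_hsphere (eqN z zJ).
apply: IHm => //; rewrite ?inE ?(negbTE aJ) ?(negbTE bJ) //; first exact: eqN.
by move=> u; rewrite inE => /andP[/eqab].
Qed.
End Spheres.

(** The edge pp' is replaced by the path p, q', q, p', and both new vertices are
    joined to the common neighbours of p and p'.  In a comparability graph q is
    to have the rank of p, and q' that of p', so that consecutive vertices of the
    path lie on different ranks. *)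
Definition subdivide (T : finType) (E : rel T) (p p' q q' : T) : rel T :=
  fun x y =>
  if x == q then [|| y == q', y == p' | E p y && E p' y] else
  if x == q' then [|| y == q, y == p | E p y && E p' y] else
  if y == q then (x == p') || E p x && E p' x else
  if y == q' then (x == p) || E p x && E p' x else
  E x y && ~~ ((x == p) && (y == p') || (x == p') && (y == p)).

(** Adding the edge pp' creates one clique for each clique of the common
    neighbourhood of p and p'. *)
Section EdgeRule.
Variables (T : finType) (E : rel T) (p p' : T).
Hypotheses (symE : symmetric E) (irrE : irreflexive E) (pp' : p != p') (Epp' : ~~ E p p').
Local Notation E2 := (add_edge E p p').

Lemma add_edgeE : add_edge E p p' p p'.
Proof. by rewrite /add_edge !eqxx orbT. Qed.

Lemma hpoly_add_edge (J : {set T}) m : p \in J -> p' \in J ->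
  hpoly E2 J m.+2 = hpoly E J m.+2 + hpoly E2 (nbh E2 (nbh E2 J p) p') m.
Proof.
move=> pJ p'J.
have symE2 := add_edge_sym p p' symE; have irrE2 := add_edge_irr irrE pp'.
rewrite (hpoly_vertex _ symE2 irrE2 pJ) (@hpoly_vertex _ E2 (nbh E2 J p) p') //; last first.
  by rewrite inE p'J add_edgeE.
rewrite (hpoly_vertex _ symE irrE pJ) addrA; congr (_ + _ + _).
  apply: eq_hpoly => x y; rewrite !inE => /andP[xp _] /andP[yp _].
  by rewrite /add_edge (negbTE xp) (negbTE yp) !andbF !orbF.
have -> : nbh E2 J p :\ p' = nbh E J p.
  apply/setP => y; rewrite !inE /add_edge eqxx (negbTE pp') /=.
  by case: (eqVneq y p') => //= [->|_]; rewrite ?(negbTE Epp') ?andbF // orbF.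
apply: eq_hpoly => x y; rewrite !inE => /andP[_ Epx] /andP[_ Epy].
have xp : x != p by apply: contraTneq Epx => ->; rewrite irrE.
have yp : y != p by apply: contraTneq Epy => ->; rewrite irrE.
by rewrite /add_edge (negbTE xp) (negbTE yp) !andbF !orbF.
Qed.
End EdgeRule.

Section Subdivision.
Variables (T : finType) (E : rel T) (p p' q q' : T).
Hypotheses (symE : symmetric E) (irrE : irreflexive E) (Epp' : E p p').
Hypotheses (qq' : q != q').
Hypotheses (isoq : forall z, E q z = false) (isoq' : forall z, E q' z = false).
Local Notation E' := (subdivide E p p' q q').

Fact neq_pq : [/\ p != p', p != q, p != q', p' != q & p' != q'].
Proof.
split; apply: contraTneq Epp' => e.
- by rewrite -e irrE.
- by rewrite e isoq.
- by rewrite e isoq'.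
- by rewrite e symE isoq.
- by rewrite e symE isoq'.
Qed.

Lemma subdivide_sym : symmetric E'.
Proof.
have [pp' pq pq' p'q p'q'] := neq_pq.
move=> x y; rewrite /subdivide.
have Cq : E p q && E p' q = false by rewrite symE isoq.
have Cq' : E p q' && E p' q' = false by rewrite symE isoq'.
case: (eqVneq x q) => [->|xq].
  case: (eqVneq y q) => [->|yq]; first by rewrite (negbTE qq').
  by case: (eqVneq y q') => [->|yq'] //=.
case: (eqVneq x q') => [->|xq'].
  case: (eqVneq y q) => [->|yq] //=.
  by case: (eqVneq y q') => [->|yq'] //=.
case: (eqVneq y q) => [_|yq] //; case: (eqVneq y q') => [_|yq'] //.
by rewrite symE; congr (_ && ~~ _); rewrite orbC; congr (_ || _); rewrite andbC.
Qed.

Lemma subdivide_irr : irreflexive E'.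
Proof.
have [pp' pq pq' p'q p'q'] := neq_pq.
move=> x; rewrite /subdivide irrE /=.
case: (eqVneq x q) => [->|xq].
  by rewrite (negbTE qq') eq_sym (negbTE p'q) /= symE isoq.
case: (eqVneq x q') => [->|//].
by rewrite eq_sym (negbTE pq') /= symE isoq'.
Qed.

Lemma subdivide_q y : E' q y = [|| y == q', y == p' | E p y && E p' y].
Proof. by rewrite /subdivide eqxx. Qed.

Lemma subdivide_q' y : E' q' y = [|| y == q, y == p | E p y && E p' y].
Proof. by rewrite /subdivide eqxx eq_sym (negbTE qq'). Qed.

Lemma subdivide_old x y : x != q -> x != q' -> y != q -> y != q' ->
  E' x y = E x y && ~~ ((x == p) && (y == p') || (x == p') && (y == p)).
Proof. by rewrite /subdivide => /negbTE-> /negbTE-> /negbTE-> /negbTE->. Qed.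

Lemma subdivideS x y : subdivide E p' p q' q x y = E' x y.
Proof.
have Cc z : E p' z && E p z = E p z && E p' z by rewrite andbC.
rewrite /subdivide !Cc; case: (eqVneq x q) => [->|xq]; first by rewrite (negbTE qq').
case: (eqVneq x q') => [_|xq'] //.
case: (eqVneq y q) => [->|yq]; first by rewrite (negbTE qq').
by case: (eqVneq y q') => [_|yq'] //; rewrite [X in ~~ X]orbC.
Qed.

Section OnSet.
Variable J : {set T}.
Hypotheses (qJ : q \notin J) (q'J : q' \notin J).

Let L := nbh E (nbh E J p) p'.
Local Notation E2 := (add_edge E' p p').

Lemma notin_neq2 x : x \in J -> (x != q) && (x != q').
Proof. by move=> xJ; apply/andP; split; apply: contraTneq xJ => ->. Qed.

Lemma subdivide_J x y : x \in J -> y \in J ->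
  E' x y = E x y && ~~ ((x == p) && (y == p') || (x == p') && (y == p)).
Proof. by move=> /notin_neq2/andP[? ?] /notin_neq2/andP[? ?]; exact: subdivide_old. Qed.

Lemma readd_edge_J : {in J &, E =2 E2}.
Proof.
move=> x y xJ yJ; rewrite /add_edge subdivide_J //.
case e: ((x == p) && (y == p') || _); last by rewrite andbT orbF.
by rewrite orbT; case/orP: e => /andP[/eqP-> /eqP->] //; rewrite symE.
Qed.

(** With the edge pp' put back, the new complex is obtained from J by first
    adding q', whose link is then a cone with apex p over the link L of pp', and
    then q, whose link is the suspension of L with apices q' and p'.  Each of the
    two steps keeps acyclicity and has a known effect on [hpoly]; removing the
    edge pp' again is [acyclic_cut_edge] and [hpoly_add_edge]. *)
Lemma spherical_subdivide m : p \in J -> p' \in J ->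
    spherical E J m.+2 -> spherical E L m ->
  spherical E' (q |: (q' |: J)) m.+2 /\
  hpoly E' (q |: (q' |: J)) m.+2 = hpoly E J m.+2 + 2 *: 'X * hpoly E L m.
Proof.
move=> pJ p'J hJ hL.
have [pp' pq pq' p'q p'q'] := neq_pq.
have symE' := subdivide_sym; have irrE' := subdivide_irr.
have symE2 := add_edge_sym p p' symE'; have irrE2 := add_edge_irr irrE' pp'.
have E'pp' : ~~ E' p p' by rewrite subdivide_J // !eqxx andbF.
have E2J := readd_edge_J.
have sLJ : {subset L <= J} by move=> z; rewrite !inE => /andP[/andP[]].
have Lp z : z \in L -> (E p z) && (E p' z) by rewrite !inE => /andP[/andP[_ ->]].
have L_neq z : z \in L -> [/\ z != p, z != p', z != q & z != q'].
  move=> zL; have /andP[-> ->] := notin_neq2 (sLJ _ zL).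
  by have /andP[Ez Ez'] := Lp _ zL; split=> //;
      [apply: contraTneq Ez|apply: contraTneq Ez'] => ->;
    rewrite irrE.
have [L_p L_p' L_q L_q'] : [/\ p \notin L, p' \notin L, q \notin L & q' \notin L].
  by split; apply/negP => /L_neq[]; rewrite eqxx.
have E2q z : E2 q z = E' q z.
  by rewrite /add_edge ![q == _]eq_sym (negbTE pq) (negbTE p'q) !orbF.
have E2q' z : E2 q' z = E' q' z.
  by rewrite /add_edge ![q' == _]eq_sym (negbTE pq') (negbTE p'q') !orbF.
have E2L : {in L &, E =2 E2} by move=> x y /sLJ xJ /sLJ yJ; exact: E2J.
have hL2 : spherical E2 L m by apply: eq_spherical E2L hL.
have hJ2 : spherical E2 J m.+2 by apply: eq_spherical E2J hJ.
have coneq z : z \in L -> E2 q z by move=> /Lp zL; rewrite E2q subdivide_q zL !orbT.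
have coneq' z : z \in L -> E2 q' z by move=> /Lp zL; rewrite E2q' subdivide_q' zL !orbT.
have conep z : z \in L -> E2 p z by move=> zL; have /andP[? ?] := Lp _ zL;
    rewrite -E2J //; exact: sLJ.
have conep' z : z \in L -> E2 p' z by move=> zL; have /andP[? ?] := Lp _ zL;
    rewrite -E2J //; exact: sLJ.
have Nq' : nbh E2 (q' |: J) q' = p |: L.
  rewrite nbhU1 irrE2; apply/setP => z; rewrite !inE E2q' subdivide_q'.
  case: (eqVneq z p) => [->|zp] /=; first by rewrite pJ orbT.
  by case: (boolP (z \in J)) => //= zJ; rewrite (negbTE (proj1 (andP (notin_neq2 zJ)))).
have Nq : nbh E2 (q |: (q' |: J)) q = q' |: (p' |: L).
  rewrite !nbhU1 irrE2 E2q subdivide_q eqxx /=; congr (_ |: _).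
  apply/setP => z; rewrite !inE E2q subdivide_q.
  case: (eqVneq z p') => [->|zp'] /=; first by rewrite p'J orbT.
  by case: (boolP (z \in J)) => //= zJ; rewrite (negbTE (proj2 (andP (notin_neq2 zJ)))).
have NN : nbh E2 (nbh E2 (q |: (q' |: J)) p) p' = L.
  rewrite !nbhU1 ![E2 p _]symE2 E2q E2q' subdivide_q subdivide_q' eqxx orbT.
  rewrite (negbTE pq') (negbTE pp') irrE /= nbhU1 symE2 E2q' subdivide_q'.
  rewrite (negbTE p'q) eq_sym (negbTE pp') irrE andbF /=.
  apply/setP => z; rewrite !inE; case: (boolP (z \in J)) => //= zJ.
  by rewrite -!E2J.
have q_out : q \notin q' |: J by rewrite !inE negb_or qq'.
have q'_p' : ~~ E2 q' p'.
  by rewrite E2q' subdivide_q' (negbTE p'q) eq_sym (negbTE pp') irrE andbF.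
have q'p' : q' != p' by rewrite eq_sym.
have bq' : bounded E2 (q' |: J) m.+2.
  apply: (@bounded_vertex _ _ _ q') => //; rewrite ?setU1K //; first by case: hJ2.
  by rewrite Nq'; apply: bounded_cone => //; case: hL2.
have hsusp : spherical E2 (q' |: (p' |: L)) m.+1 by apply: spherical_susp.
have hsE2 : hpoly E2 (q |: (q' |: J)) m.+2 = hpoly E J m.+2 + (2 *: 'X + 1) * hpoly E L m.
  rewrite (@hpoly_vertex _ E2 _ q) ?setU11 // setU1K // Nq hpoly_susp //.
  rewrite (@hpoly_vertex _ E2 _ q') ?setU11 // setU1K // Nq' hpoly_cone //;
      last by case: hL2.
  rewrite -(eq_hpoly _ E2J) -(eq_hpoly _ E2L) -mul_polyC; ring.
have hsE' : hpoly E' (q |: (q' |: J)) m.+2 = hpoly E J m.+2 + 2 *: 'X * hpoly E L m.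
  have := hpoly_add_edge symE' irrE' pp' E'pp' m (setU1r q (setU1r q' pJ)) (setU1r q
      (setU1r q' p'J)).
  rewrite hsE2 NN -(eq_hpoly _ E2L) mulrDl mul1r addrA.
  by move/addIr.
split=> //; split.
- move=> A hA; suff: bounded E2 (q |: (q' |: J)) m.+2.
    apply; case/cliqueP: hA => sA h; apply/cliqueP; split=> // x y xA yA xy.
    by rewrite /add_edge h.
  apply: (@bounded_vertex _ _ _ q) => //; rewrite ?setU1K // Nq.
  by case: hsusp.
- apply: (@acyclic_cut_edge _ E' _ _ p p' q q') => //.
  + by rewrite /= !inE !negb_or pp' pq pq' p'q p'q' qq'.
  + by move=> z; rewrite !inE => /or4P[]/eqP->; rewrite ?eqxx ?pJ ?p'J ?orbT.
  + by rewrite symE' subdivide_q (negbTE pq') (negbTE pp') irrE.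
  + by rewrite symE' subdivide_q' (negbTE p'q) eq_sym (negbTE pp') irrE andbF.
  + by rewrite subdivide_q eqxx.
  + by rewrite subdivide_q eqxx orbT.
  + by rewrite symE' subdivide_q' eqxx orbT.
  + move=> z; rewrite !inE => /or3P[/eqP->|/eqP->|zJ].
    * by rewrite symE' subdivide_q (negbTE pq') (negbTE pp') irrE.
    * move=> _; rewrite symE' subdivide_q' (negbTE p'q) eq_sym (negbTE pp') irrE andbF.
      by [].
    rewrite [E' p z]subdivide_J // [E' p' z]subdivide_J // => /andP[Epz _] /andP[Ep'z _].
    by rewrite subdivide_q subdivide_q' Epz Ep'z !orbT.
  apply: (@acyclic_vertex _ _ _ q); rewrite ?setU11 // ?setU1K // ?Nq; last by case: hsusp.
  apply: (@acyclic_vertex _ _ _ q'); rewrite ?setU11 // ?setU1K // ?Nq'; first by case: hJ2.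
  exact: acyclic_coneU1.
- rewrite hsE' coefD -scalerAl coefZ coefXM /= mulr0 addr0.
  by case: hJ.
Qed.
End OnSet.
End Subdivision.

(** * Links in a subdivision *)
Section SubdivisionLinks.
Variables (T : finType) (E : rel T) (p p' q q' : T).
Hypotheses (symE : symmetric E) (irrE : irreflexive E) (Epp' : E p p').
Hypotheses (qq' : q != q').
Hypotheses (isoq : forall z, E q z = false) (isoq' : forall z, E q' z = false).
Local Notation E' := (subdivide E p p' q q').
Variable J : {set T}.
Hypotheses (qJ : q \notin J) (q'J : q' \notin J) (pJ : p \in J) (p'J : p' \in J).
Let L := nbh E (nbh E J p) p'.

Let npq := neq_pq symE irrE Epp' isoq isoq'.
Let symE' := subdivide_sym symE irrE Epp' qq' isoq isoq'.
Let irrE' := subdivide_irr symE irrE Epp' qq' isoq isoq'.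
Let E'J := subdivide_J E p p' qJ q'J.

(** The link of q is the suspension of the link of pp' with apices q' and p'. *)
Lemma hsphere_nbh_new m : hsphere E J m.+2 -> hsphere E' (nbh E' (q |: (q' |: J)) q) m.+1.
Proof.
move=> hJ; have [pp' pq pq' p'q p'q'] := npq.
have hL : hsphere E L m.
  by have := hsphere_nbh (hsphere_nbh hJ pJ) (_ : p' \in nbh E J p); apply; rewrite inE p'J.
have LE z : z \in L -> [/\ z \in J, E p z & E p' z].
  by rewrite !inE => /andP[/andP[? ?] ?].
have Lpp' z : z \in L -> (z != p) && (z != p').
  move=> /LE[_ Ez Ez']; apply/andP; split;
      [apply: contraTneq Ez|apply: contraTneq Ez'] => ->;
  by rewrite irrE.
have -> : nbh E' (q |: (q' |: J)) q = q' |: (p' |: L).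
  rewrite !nbhU1 irrE' (subdivide_q _ _ _ _ _ q') eqxx /=; congr (_ |: _).
  apply/setP => z; rewrite !inE subdivide_q.
  case: (eqVneq z p') => [->|zp'] /=; first by rewrite p'J orbT.
  by case: (boolP (z \in J)) => //= zJ;
      rewrite (negbTE (proj2 (andP (notin_neq2 qJ q'J zJ)))).
apply: hsphere_susp => //.
- by apply/negP => /LE[]; rewrite (negbTE q'J).
- by apply/negP => /Lpp'; rewrite eqxx andbF.
- by rewrite eq_sym.
- by rewrite subdivide_q' // (negbTE p'q) eq_sym (negbTE pp') irrE andbF.
- by move=> z /LE[_ Ez Ez']; rewrite subdivide_q' // Ez Ez' !orbT.
- move=> z zL; have [zJ Ez Ez'] := LE z zL; have /andP[zp zp'] := Lpp' z zL.
  by rewrite E'J // Ez' (negbTE zp) (negbTE zp') !andbF.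
apply: eq_hsphere hL => x y xL yL; have [xJ _ _] := LE x xL; have [yJ _ _] := LE y yL.
by have /andP[xp xp'] := Lpp' x xL; rewrite E'J // (negbTE xp) (negbTE xp') andbT.
Qed.

Lemma nbh_old : nbh E' (q |: (q' |: J)) p = q' |: (nbh E J p :\ p').
Proof.
have [pp' pq pq' p'q p'q'] := npq.
rewrite !nbhU1 symE' subdivide_q (negbTE pq') (negbTE pp') irrE /=.
rewrite symE' subdivide_q' // eqxx orbT; congr (_ |: _).
apply/setP => z; rewrite !inE; case: (boolP (z \in J)) => zJ; rewrite /= ?andbF //.
by rewrite E'J // eqxx (negbTE pp') /= orbF andbC.
Qed.

(** In the link of p the vertex q' takes the place of p'. *)
Lemma hsphere_nbh_old m : hsphere E J m.+2 -> hsphere E' (nbh E' (q |: (q' |: J)) p) m.+1.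
Proof.
move=> hJ; have [pp' pq pq' p'q p'q'] := npq.
have p'N : p' \in nbh E J p by rewrite inE p'J.
rewrite nbh_old; apply: (@hsphere_rename _ E E' _ p' q' m.+1 symE symE' irrE irrE').
- by rewrite setD11.
- by rewrite !inE (negbTE q'J) /= andbF.
- by [].
- move=> x y; rewrite !inE => /and3P[xp' xJ Epx] /and3P[yp' yJ Epy].
  by rewrite E'J // (negbTE xp') (negbTE yp') !andbF andbT.
- move=> y; rewrite !inE => /and3P[yp' yJ Epy].
  rewrite subdivide_q' // Epy (negbTE (proj1 (andP (notin_neq2 qJ q'J yJ)))) /=.
  by case: (eqVneq y p) Epy => // ->; rewrite irrE.
by rewrite setD1K //; exact: hsphere_nbh hJ pJ.
Qed.
End SubdivisionLinks.

Section Subdivided.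
Variables (T : finType) (E : rel T) (p p' q q' : T).
Hypotheses (symE : symmetric E) (irrE : irreflexive E) (Epp' : E p p').
Hypotheses (qq' : q != q').
Hypotheses (isoq : forall z, E q z = false) (isoq' : forall z, E q' z = false).
Local Notation E' := (subdivide E p p' q q').
Let npq := neq_pq symE irrE Epp' isoq isoq'.
Let symE' := subdivide_sym symE irrE Epp' qq' isoq isoq'.
Let irrE' := subdivide_irr symE irrE Epp' qq' isoq isoq'.

(** By induction on m: a vertex adjacent to both p and p' has the subdivision of
    its old link as new link, the links of other old vertices away from the edge
    are unchanged, and [subdivideS] reduces q' and p' to q and p. *)
Lemma hsphere_subdivide (J : {set T}) m : q \notin J -> q' \notin J -> p \in J -> p' \in
    J ->
  hsphere E J m -> hsphere E' (q |: (q' |: J)) m.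
Proof.
have [pp' pq pq' p'q p'q'] := npq.
have swp (K : {set T}) n : hsphere (subdivide E p' p q' q) K n -> hsphere E' K n.
  by apply: eq_hsphere => x y _ _; exact: subdivideS.
have nswp (K : {set T}) x : nbh (subdivide E p' p q' q) K x = nbh E' K x.
  by apply/setP => y; rewrite !inE subdivideS.
elim: m J => [|m IHm] J qJ q'J pJ p'J hJ; first by have := hsphere_gt0 hJ pJ.
have p'N : p' \in nbh E J p by rewrite inE p'J.
case: m IHm hJ => [|m] IHm hJ; first by have := hsphere_gt0 (hsphere_nbh hJ pJ) p'N.
have hL := hsphere_nbh (hsphere_nbh hJ pJ) p'N.
split.
  by apply: (proj1 (spherical_subdivide _ _ _ _ _ _ _ _ _ _ _ _)) => //;
      exact: hsphere_spherical.
have Ep'p : E p' p by rewrite symE.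
have q'q : q' != q by rewrite eq_sym.
move=> z; rewrite !inE => /or3P[/eqP->|/eqP->|zJ].
- exact: hsphere_nbh_new.
- by rewrite setUCA -nswp; apply: swp; apply: hsphere_nbh_new.
case: (eqVneq z p) => [->|zp]; first exact: hsphere_nbh_old.
case: (eqVneq z p') => [->|zp'].
  by rewrite setUCA -nswp; apply: swp; apply: hsphere_nbh_old.
have /andP[zq zq'] := notin_neq2 qJ q'J zJ.
have NJ : nbh E' J z = nbh E J z.
  apply/setP => y; rewrite !inE; case: (boolP (y \in J)) => //= yJ.
  by rewrite (subdivide_J E p p' qJ q'J) // (negbTE zp) (negbTE zp') andbT.
have hz := hsphere_nbh hJ zJ.
have Ezq : E' z q = E p z && E p' z.
  by rewrite symE' subdivide_q (negbTE zq') (negbTE zp').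
have Ezq' : E' z q' = E p z && E p' z.
  by rewrite symE' subdivide_q' // (negbTE zq) (negbTE zp).
rewrite !nbhU1 Ezq Ezq' NJ; case Cz: (E p z && E p' z).
  have [Ez Ez'] := andP Cz; apply: IHm hz;
      rewrite ?inE ?(negbTE qJ) ?(negbTE q'J) ?pJ ?p'J //.
    by rewrite symE.
  by rewrite symE.
apply: eq_hsphere hz => x y; rewrite !inE => /andP[xJ Ezx] /andP[yJ Ezy].
rewrite (subdivide_J E p p' qJ q'J) //.
case e: (_ || _); last by rewrite andbT.
move: Cz; rewrite ![E _ z]symE; case/orP: e => /andP[/eqP <- /eqP <-].
  by rewrite Ezx Ezy.
by rewrite Ezx Ezy.
Qed.
End Subdivided.

(** The link of a sequence of vertices; for a clique s this is its link in the
    clique complex of V. *)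
Definition link (T : finType) (E : rel T) (V : {set T}) (s : seq T) : {set T} :=
  foldr (fun x J => nbh E J x) V s.

Section Links.
Variables (T : finType) (E : rel T) (V : {set T}).

Lemma in_link s y : (y \in link E V s) = (y \in V) && all (E^~ y) s.
Proof.
elim: s => [|x s IHs] /=; first by rewrite andbT.
by rewrite inE IHs -andbA [all _ _ && _]andbC.
Qed.

Lemma hsphere_link d s : symmetric E -> hsphere E V d -> {subset s <= V} ->
  pairwise E s -> hsphere E (link E V s) (d - size s).
Proof.
move=> symE hV; elim: s => [|x s IHs] sV /=; first by rewrite subn0.
case/andP => hx hs; have {}IHs := IHs (fun y ys => sV y (mem_behead (s := x :: s) ys)) hs.
rewrite subnS; apply: hsphere_nbh IHs _; rewrite in_link sV ?mem_head //=.
by apply/allP => y ys; rewrite symE; exact: (allP hx).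
Qed.
End Links.

Lemma pairwise_in (T : eqType) (E : rel T) (s : seq T) : symmetric E -> pairwise E s ->
  {in s &, forall x y, x != y -> E x y}.
Proof.
move=> symE; elim: s => //= x s IHs /andP[hx /IHs{}IHs] y z.
rewrite !inE => /predU1P[->|ys] /predU1P[->|zs]; rewrite ?eqxx // => yz.
- exact: (allP hx).
- by rewrite symE; exact: (allP hx).
- exact: IHs.
Qed.

(** How the h-polynomials of links of old cliques s change.  There are three
    cases: s spans a simplex with pp', so that its link is itself subdivided; s
    contains p or p', so that at most a vertex is renamed in its link; otherwise
    the link does not contain the edge pp' and does not change. *)
Section TrackLinks.
Variables (T : finType) (E : rel T) (p p' q q' : T).
Hypotheses (symE : symmetric E) (irrE : irreflexive E) (Epp' : E p p').
Hypotheses (qq' : q != q').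
Hypotheses (isoq : forall z, E q z = false) (isoq' : forall z, E q' z = false).
Local Notation E' := (subdivide E p p' q q').
Variables (V : {set T}).
Hypotheses (qV : q \notin V) (q'V : q' \notin V) (pV : p \in V) (p'V : p' \in V).
Local Notation V' := (q |: (q' |: V)).
Let npq := neq_pq symE irrE Epp' isoq isoq'.
Let symE' := subdivide_sym symE irrE Epp' qq' isoq isoq'.
Let irrE' := subdivide_irr symE irrE Epp' qq' isoq isoq'.

Variables (s : seq T).
Hypotheses (sV : {subset s <= V}) (Us : pairwise E' s).

Lemma sub_subdivide x y : x \in V -> y \in V -> E' x y -> E x y.
Proof. by move=> xV yV; rewrite (subdivide_J E p p' qV q'V) // => /andP[]. Qed.

Let ps_p's : p \in s -> p' \in s -> False.
Proof.
have [pp' _ _ _ _] := npq.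
move=> ps p's; have := pairwise_in symE' Us ps p's pp'.
by rewrite (subdivide_J E p p' qV q'V) // !eqxx andbF.
Qed.

Let link_old y : y \in V -> ~ (p \in s /\ y = p') -> ~ (p' \in s /\ y = p) ->
  (y \in link E' V' s) = (y \in link E V s).
Proof.
move=> yV h1 h2; rewrite !in_link !inE yV !orbT /=; apply: eq_in_all => x xs.
rewrite (subdivide_J E p p' qV q'V) //; [|exact: sV];
    case e: ((x == p) && (y == p') || _); last by rewrite andbT.
case/orP: e => /andP[/eqP ex /eqP ey]; [case: h1|case: h2]; by rewrite -ex -ey.
Qed.

Lemma hpoly_link_join m : all (E p) s -> all (E p') s -> hsphere E (link E V s) m ->
  hpoly E' (link E' V' s) m =
    hpoly E (link E V s) m + 2 *: 'X * hpoly E (link E V [:: p', p & s]) (m - 2).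
Proof.
move=> sp sp' hs; have [pp' pq pq' p'q p'q'] := npq.
have Np : p \notin s by apply/negP => /(allP sp); rewrite irrE.
have Np' : p' \notin s by apply/negP => /(allP sp'); rewrite irrE.
have -> : link E' V' s = q |: (q' |: link E V s).
  apply/setP => y; rewrite ![in RHS]inE.
  case: (eqVneq y q) => [->|yq] /=.
    rewrite in_link !inE eqxx /=; apply/allP => x xs.
    by rewrite symE' subdivide_q (allP sp) ?(allP sp') // !orbT.
  case: (eqVneq y q') => [->|yq'] /=.
    rewrite in_link !inE eqxx /= orbT /=; apply/allP => x xs.
    by rewrite symE' subdivide_q' // (allP sp) ?(allP sp') // !orbT.
  case: (boolP (y \in V)) => yV;
      last by rewrite !in_link !inE (negbTE yq) (negbTE yq') (negbTE yV).
  by apply: link_old => // -[]; [rewrite (negbTE Np)|rewrite (negbTE Np')].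
have pl : p \in link E V s by rewrite in_link pV /=; apply/allP => x xs;
    rewrite symE (allP sp).
have pl' : p' \in link E V s by rewrite in_link p'V /=; apply/allP => x xs;
    rewrite symE (allP sp').
have pl'' : p' \in nbh E (link E V s) p by rewrite inE pl'.
have hs1 := hsphere_nbh hs pl; have hs2 := hsphere_nbh hs1 pl''.
case: m hs hs1 hs2 => [|[|m]] hs hs1 hs2.
- by have := hsphere_gt0 hs pl.
- by have := hsphere_gt0 hs1 pl''.
rewrite subn2 /=.
apply: (proj2 (spherical_subdivide _ _ _ _ _ _ _ _ _ _ _ _)) => //.
- by rewrite in_link (negbTE qV).
- by rewrite in_link (negbTE q'V).
- exact: hsphere_spherical.
- exact: hsphere_spherical hs2.
Qed.

Lemma hpoly_link_in m : p \in s -> hsphere E (link E V s) m ->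
  hpoly E' (link E' V' s) m = hpoly E (link E V s) m.
Proof.
move=> ps hs; have [pp' pq pq' p'q p'q'] := npq.
have Np' : p' \notin s by apply/negP => /(ps_p's ps).
have qn : q \notin link E' V' s.
  rewrite in_link; apply/nandP; right; apply/negP => /allP/(_ p ps).
  by rewrite symE' subdivide_q (negbTE pq') (negbTE pp') irrE.
have p'n : p' \notin link E' V' s.
  rewrite in_link; apply/nandP; right; apply/negP => /allP/(_ p ps).
  by rewrite (subdivide_J E p p' qV q'V) // !eqxx andbF.
have pn : p \notin link E V s.
  by rewrite in_link; apply/nandP; right; apply/negP => /allP/(_ p ps); rewrite irrE.
have EE : {in link E V s :\ p' &, E =2 E'}.
  move=> x y; rewrite !inE !in_link => /and3P[xp' xV _] /and3P[yp' yV _].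
  by rewrite (subdivide_J E p p' qV q'V) // (negbTE xp') (negbTE yp') !andbF andbT.
have q'E : (q' \in link E' V' s) = (p' \in link E V s).
  rewrite !in_link !inE eqxx p'V orbT /=; apply: eq_in_all => x xs.
  rewrite symE' subdivide_q' // [E x p']symE.
  have xV := sV xs; have /andP[/negbTE-> _] := notin_neq2 qV q'V xV => /=.
  case: (eqVneq x p) => [->|xp] /=; first by rewrite symE Epp'.
  have E'px : E' p x by apply: pairwise_in Us _ _ ps xs _; rewrite // eq_sym.
  by rewrite (sub_subdivide pV xV E'px).
have lkN y : y \in V -> y != p' -> (y \in link E' V' s) = (y \in link E V s).
  move=> yV yp'; apply: link_old => // -[]; last by rewrite (negbTE Np').
  by move=> _ yp; rewrite yp eqxx in yp'.
have lk'E : link E' V' s =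
    if p' \in link E V s then q' |: (link E V s :\ p') else link E V s :\ p'.
  apply/setP => y; case: (eqVneq y q') => [->|yq'].
    rewrite q'E; case: ifP => _; rewrite !inE ?eqxx //= in_link (negbTE q'V) andbF.
    by [].
  have -> : (y \in (if p' \in link E V s then q' |: (link E V s :\ p') else link E V s :\
      p'))
      = (y \in link E V s :\ p').
    by case: ifP => _; rewrite // [LHS]inE inE (negbTE yq').
  case: (eqVneq y q) => [->|yq];
      first by rewrite (negbTE qn) !inE in_link (negbTE qV) andbF.
  case: (eqVneq y p') => [->|yp']; first by rewrite (negbTE p'n) !inE eqxx.
  rewrite !inE yp' /=; case: (boolP (y \in V)) => yV; first exact: lkN.
  by rewrite !in_link !inE (negbTE yq) (negbTE yq') (negbTE yV).
rewrite lk'E; case: ifP => p'l; last first.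
  have -> : link E V s :\ p' = link E V s by apply/setDidPl;
      rewrite disjoint_sym disjoints1 p'l.
  apply/esym/eq_hpoly => x y xl yl; apply: EE; rewrite !inE ?xl ?yl andbT.
    by apply: contraFneq p'l => <-.
  by apply: contraFneq p'l => <-.
have m0 := hsphere_gt0 hs p'l; case: m hs m0 => // m hs _.
rewrite -[in RHS](setD1K p'l); apply/esym.
apply: (hpoly_rename m symE symE' irrE irrE' _ _ EE); rewrite ?setD11 //.
  by rewrite !inE in_link (negbTE q'V) andbF.
move=> y; rewrite !inE in_link => /and3P[yp' yV /allP/(_ p ps) Epy].
rewrite subdivide_q' // Epy /=; have /andP[/negbTE-> _] := notin_neq2 qV q'V yV => /=.
by case: (eqVneq y p) Epy => // ->; rewrite irrE.
Qed.

Lemma hpoly_link_off m : p \notin s -> p' \notin s -> ~~ (all (E p) s && all (E p') s) ->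
  hpoly E' (link E' V' s) m = hpoly E (link E V s) m.
Proof.
move=> ps p's hC; have [pp' pq pq' p'q p'q'] := npq.
have aC : all (fun x => E p x && E p' x) s = all (E p) s && all (E p') s.
  by elim: (s) => //= x s' ->; rewrite andbACA.
have -> : link E' V' s = link E V s.
  apply/setP => y; case: (boolP (y \in V)) => yV.
    by apply: link_old => // -[]; [rewrite (negbTE ps)|rewrite (negbTE p's)].
  rewrite !in_link !inE (negbTE yV) !orbF; apply/negP => /andP[yqq' /allP hy].
  move: hC; rewrite -aC => /allP; apply => x xs; have := hy x xs.
  have xp : x != p by apply: contraTneq xs => ->.
  have xp' : x != p' by apply: contraTneq xs => ->.
  have /andP[xq xq'] := notin_neq2 qV q'V (sV xs).
  case/orP: yqq' => /eqP->; rewrite symE' ?subdivide_q ?subdivide_q' //.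
    by rewrite (negbTE xq') (negbTE xp').
  by rewrite (negbTE xq) (negbTE xp).
apply/esym/eq_hpoly => x y; rewrite !in_link => /andP[xV hx] /andP[yV hy].
rewrite (subdivide_J E p p' qV q'V) //; case e: ((x == p) && (y == p') || _);
    last by rewrite /= ?andbT.
have hC' : all (E^~ p) s && all (E^~ p') s = false.
  apply: contraNF hC => /andP[h h'].
  by apply/andP; split; apply/allP => z zs; rewrite symE;
      [exact: (allP h)|exact: (allP h')].
by case/orP: e hC' => /andP[/eqP<- /eqP<-]; rewrite hx hy.
Qed.
End TrackLinks.

Lemma hpoly_link_subdivide (T : finType) (E : rel T) (p p' q q' : T) (V : {set T}) s m :
    symmetric E -> irreflexive E -> E p p' -> q != q' ->
    (forall z, E q z = false) -> (forall z, E q' z = false) ->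
    q \notin V -> q' \notin V -> p \in V -> p' \in V ->
    {subset s <= V} -> pairwise (subdivide E p p' q q') s -> hsphere E (link E V s) m ->
  hpoly (subdivide E p p' q q') (link (subdivide E p p' q q') (q |: (q' |: V)) s) m =
    hpoly E (link E V s) m +
    (if all (E p) s && all (E p') s then
       2 *: 'X * hpoly E (link E V [:: p', p & s]) (m - 2) else 0).
Proof.
move=> symE irrE Epp' qq' isoq isoq' qV q'V pV p'V sV Us hs.
case: ifP => [/andP[sp sp']|/negbT hC].
  exact: hpoly_link_join.
rewrite addr0; case: (boolP (p \in s)) => ps; first exact: hpoly_link_in.
case: (boolP (p' \in s)) => p's; last exact: hpoly_link_off.
have swp : subdivide E p' p q' q =2 subdivide E p p' q q' by move=> x y; rewrite subdivideS.
rewrite setUCA -(@hpoly_link_in _ E p' p q' q _ _ _ _ _ _ V _ _ _ _ s) //;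
    try by rewrite eq_sym.
- have -> : link (subdivide E p' p q' q) (q' |: (q |: V)) s = link (subdivide E p p' q
    q') (q' |: (q |: V)) s.
    by apply/setP => y; rewrite !in_link; congr (_ && _); apply: eq_all => x /=.
  by apply: eq_hpoly => x y _ _; rewrite swp.
- by rewrite symE.
- by have := eq_pairwise swp s; rewrite /in_mem /= => ->.
Qed.

(** * Ranked spheres *)

(** The order complex of a graded poset without its extrema, kept as a
    comparability graph E on V together with the rank function r.  The last
    condition says that E and r define a transitive relation. *)
Record ranked_sphere (T : finType) (V : {set T}) (E : rel T) (r : T -> nat) (d : nat) :
    Prop :=
  RankedSphere {
    sphere_sym : symmetric E;
    sphere_irr : irreflexive E;
    sphere_suppl : forall x y, E x y -> x \in V;
    sphere_hsphere : hsphere E V d;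
    sphere_rank : forall x, x \in V -> (0 < r x <= d)%N;
    sphere_adj : forall x y, E x y -> r x != r y;
    sphere_trans : forall x y z,
        E x y -> E y z -> (r x < r y)%N -> (r y < r z)%N -> E x z }.

Section SubdividedSphere.
Variables (T : finType) (V : {set T}) (E : rel T) (r : T -> nat) (d : nat) (p p' q q' : T).
Hypotheses (hV : ranked_sphere V E r d) (Epp' : E p p') (rpp' : r p' = (r p).+1).
Hypotheses (qq' : q != q') (qV : q \notin V) (q'V : q' \notin V).

Definition new_rank x := if x == q then r p else if x == q' then r p' else r x.

Let symE := sphere_sym hV.
Let irrE := sphere_irr hV.

Lemma sphere_isolated z : z \notin V -> forall y, E z y = false.
Proof. by move=> zV y; apply: contraNF zV => /(sphere_suppl hV). Qed.

Lemma sphere_suppr x y : E x y -> y \in V.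
Proof. by rewrite symE => /(sphere_suppl hV). Qed.

(** The point is transitivity.  It holds because every common neighbour
    of p and p' lies below both of them or above both of them: there is no rank
    in between. *)
Lemma ranked_sphere_subdivide :
  ranked_sphere (q |: (q' |: V)) (subdivide E p p' q q') new_rank d.
Proof.
have isoq := sphere_isolated qV; have isoq' := sphere_isolated q'V.
have [pp' pq pq' p'q p'q'] := neq_pq symE irrE Epp' isoq isoq'.
have pV := sphere_suppl hV Epp'; have p'V := sphere_suppr Epp'.
have symE' := subdivide_sym symE irrE Epp' qq' isoq isoq'.
have irrE' := subdivide_irr symE irrE Epp' qq' isoq isoq'.
have adj := sphere_adj hV; have trans := sphere_trans hV.
pose E' := subdivide E p p' q q'.
have rq : new_rank q = r p by rewrite /new_rank eqxx.
have rq' : new_rank q' = r p' by rewrite /new_rank eqxx eq_sym (negbTE qq').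
have rV x : x != q -> x != q' -> new_rank x = r x by rewrite /new_rank => /negbTE->
    /negbTE->.
have rold x : x \in V -> new_rank x = r x by move=> /(notin_neq2 qV q'V)/andP[? ?];
    exact: rV.
have rp := rold p pV; have rp' := rold p' p'V.
have E'old x y : x \in V -> y \in V -> E' x y -> E x y.
  move=> xV yV; rewrite /E' (subdivide_J E p p' qV q'V) //; by case/andP.
have EV x y : x \in V -> y \in V -> E x y -> ((x == p) && (y == p') || (x == p') && (y ==
    p)) = false -> E' x y.
  by move=> xV yV Exy e; rewrite /E' (subdivide_J E p p' qV q'V) // Exy e.
have supp' x y : E' x y -> x \in q |: (q' |: V).
  rewrite /E' /subdivide !inE; case: (eqVneq x q) => //= xq; case: (eqVneq x q') => //= xq'.
  case: ifP => _; first by case/orP => [/eqP->//|/andP[_]];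
      rewrite symE => /(sphere_suppl hV).
  case: ifP => _; first by case/orP => [/eqP->//|/andP[_]];
      rewrite symE => /(sphere_suppl hV).
  by case/andP => /(sphere_suppl hV).
have common x : E p x && E p' x -> x \in V /\ ((r x < r p)%N \/ (r p' < r x)%N).
  case/andP => Ep Ep'; split; first exact: sphere_suppr Ep.
  by move: (adj _ _ Ep) (adj _ _ Ep'); rewrite rpp'; clear; lia.
split=> //.
- apply: hsphere_subdivide => //; exact: sphere_hsphere hV.
- move=> x; rewrite !inE => /or3P[/eqP->|/eqP->|xV]; rewrite ?rq ?rq' ?rold //;
    exact: (sphere_rank hV).
- move=> x y; rewrite -/(E' x y) => Exy; have xV := supp' _ _ Exy;
    have yV : y \in q |: (q' |: V).
    by apply: (supp' _ x); rewrite /E' symE'.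
  have adjq z : E' q z -> r p != new_rank z.
    rewrite /E' subdivide_q => /or3P[/eqP->|/eqP->|/common[zV]];
        rewrite ?rq' ?rp' ?rold // rpp'; clear; lia.
  have adjq' z : E' q' z -> r p' != new_rank z.
    rewrite /E' subdivide_q' // => /or3P[/eqP->|/eqP->|/common[zV]];
        rewrite ?rq ?rp ?rold // rpp'; clear; lia.
  move: xV yV Exy; rewrite !inE => /or3P[/eqP->|/eqP->|xV]; rewrite ?rq ?rq';
      try by move=> _ /adjq.
    by move=> _ /adjq'.
  move=> /or3P[/eqP->|/eqP->|yV]; rewrite ?rq ?rq' eq_sym.
  + by rewrite /E' symE' => /adjq.
  + by rewrite /E' symE' => /adjq'.
  by move/(E'old _ _ xV yV)/adj; rewrite eq_sym !rold.
have below_q x : E' x q -> (new_rank x < r p)%N -> [/\ x \in V, E p x,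
    E p' x & (r x < r p)%N].
  rewrite /E' symE' subdivide_q => /or3P[/eqP->|/eqP->|h].
  - by rewrite rq' rpp' ltnNge leqnSn.
  - by rewrite rp' rpp' ltnNge leqnSn.
  by have [xV _] := common _ h; rewrite rold // => ?; case/andP: h.
have below_q' x : E' x q' -> (new_rank x < r p')%N ->
   [\/ x = q, x = p | [/\ x \in V, E p x, E p' x & (r x < r p)%N]].
  rewrite /E' symE' subdivide_q' // => /or3P[/eqP->|/eqP->|h];
      [by constructor 1|by constructor 2|].
  have [xV rx] := common _ h; rewrite rold // => lx; constructor 3; case/andP: h;
      split=> //.
  by case: rx => // lx'; have := ltn_trans lx lx'; rewrite ltnn.
have above_q x : E' q x -> (r p < new_rank x)%N ->
   [\/ x = q', x = p' | [/\ x \in V, E p x, E p' x & (r p' < r x)%N]].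
  rewrite /E' subdivide_q => /or3P[/eqP->|/eqP->|h]; [by constructor 1|by constructor 2|].
  have [xV rx] := common _ h; rewrite rold // => lx; constructor 3; case/andP: h;
      split=> //.
  by case: rx => // lx'; have := ltn_trans lx lx'; rewrite ltnn.
have above_q' x : E' q' x -> (r p' < new_rank x)%N -> [/\ x \in V, E p x,
    E p' x & (r p' < r x)%N].
  rewrite /E' subdivide_q' // => /or3P[/eqP->|/eqP->|h].
  - by rewrite rq rpp' ltnNge leqnSn.
  - by rewrite rp rpp' ltnNge leqnSn.
  by have [xV _] := common _ h; rewrite rold // => ?; case/andP: h.
have to_q x : E p x -> E p' x -> E' x q by move=> h h';
    rewrite /E' symE' subdivide_q h h' !orbT.
have to_q' x : E p x -> E p' x -> E' x q' by move=> h h';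
    rewrite /E' symE' subdivide_q' // h h' !orbT.
have of_q x : E p x -> E p' x -> E' q x by move=> h h'; rewrite /E' subdivide_q h h' !orbT.
have of_q' x : E p x -> E p' x -> E' q' x by move=> h h';
    rewrite /E' subdivide_q' // h h' !orbT.
have EVr x y : x \in V -> y \in V -> E x y -> ((r x).+1 < r y)%N -> E' x y.
  move=> xV yV Exy lt; apply: EV => //; apply/negbTE/negP => /orP[]/andP[/eqP ex /eqP ey].
    by move: lt; rewrite ex ey rpp' ltnn.
  by move: lt; rewrite ex ey rpp' ltnNge ltnW // ltnW.
have far a b : (r a < r p)%N -> (r p' < r b)%N -> ((r a).+1 < r b)%N.
  by rewrite rpp' => la lb; apply: leq_ltn_trans lb; exact: ltnW.
have through a b : (r a < r p)%N -> (r p' < r b)%N -> a \in V -> b \in V -> E p a -> E p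
    b -> E' a b.
  move=> la lb aV bV pa pb; apply: EVr => //; last exact: far.
  by apply: (trans _ p) => //; [rewrite symE|apply: ltn_trans lb; rewrite rpp'].
move=> x y z; rewrite -/(E' x y) -/(E' y z) -/(E' x z) => Exy Eyz.
have xV' := supp' _ _ Exy; have yV' := supp' _ _ Eyz.
have zV' : z \in q |: (q' |: V) by apply: (supp' _ y); rewrite /E' symE'.
move: xV' yV' zV' Exy Eyz; rewrite !inE.
move=> xV yV zV Exy Eyz; case/or3P: yV Exy Eyz => [/eqP->|/eqP->|yV].
- rewrite rq => Exq Eqz lx lz; have [xV1 px p'x rx] := below_q _ Exq lx.
  case: (above_q _ Eqz lz) => [->|->|[zV1 pz p'z rz]]; [exact: to_q'| |exact: through].
  by apply: EVr => //; [rewrite symE|rewrite rpp'].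
- rewrite rq' => Exq Eqz lx lz; have [zV1 pz p'z rz] := above_q' _ Eqz lz.
  case: (below_q' _ Exq lx) => [->|->|[xV1 px p'x rx]]; [exact: of_q| |exact: through].
  by apply: EVr => //; apply: leq_ltn_trans rz; rewrite rpp'.
rewrite (rold y yV) => Exy Eyz.
have zold : (r p' <= r y)%N -> (r y < new_rank z)%N -> [/\ z \in V, E y z & (r y < r z)%N].
  move=> py lz; have zV2 : z \in V.
    case/or3P: zV lz => [/eqP->|/eqP->|//]; last by rewrite rq' ltnNge py.
    by rewrite rq ltnNge (leq_trans _ py) // rpp'.
  by rewrite rold // in lz; split=> //; apply: E'old.
have above : [\/ y = p' | [/\ E p y, E p' y & (r p' < r y)%N]] -> (r y < new_rank z)%N ->
    E p z /\ E p' z.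
  case=> [ey|[py p'y lp'y]] lz.
    have [|zV2 Eyz2 lz2] := zold _ lz; first by rewrite ey.
    rewrite ey in Eyz2 lz2; split=> //.
    by apply: (trans _ p') => //; rewrite rpp'.
  have [|zV2 Eyz2 lz2] := zold _ lz; first exact: ltnW.
  split; last exact: (trans _ y).
  by apply: (trans _ y) => //; apply: ltn_trans lp'y; rewrite rpp'.
case/or3P: xV Exy => [/eqP->|/eqP->|xV] Exy.
- rewrite rq => ly lz; have [|pz p'z] := above _ lz; last exact: of_q.
  have := above_q y Exy; rewrite rold // => /(_ ly) [ey|->|[_ ? ? ?]]; [|by left|by right].
  by rewrite ey (negbTE q'V) in yV.
- rewrite rq' => ly lz; have [|pz p'z] := above _ lz; last exact: of_q'.
  by have := above_q' y Exy; rewrite rold // => /(_ ly) [_ ? ? ?]; right.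
rewrite rold // => lx; have {}Exy := E'old _ _ xV yV Exy.
case/or3P: zV Eyz => [/eqP->|/eqP->|zV] Eyz.
- rewrite rq => ly; have := below_q y Eyz; rewrite rold // => /(_ ly) [_ py p'y _].
  apply: to_q; rewrite symE; apply: (trans _ y) => //; rewrite 1?symE //.
  by rewrite rpp' ltnW.
- rewrite rq' => ly; have := below_q' y Eyz; rewrite rold // => /(_ ly).
  case=> [ey|ey|[_ py p'y lyp]]; first by rewrite ey (negbTE qV) in yV.
    rewrite ey in Exy lx ly; apply: to_q'; rewrite symE //; exact: (trans _ p).
  apply: to_q'; rewrite symE; apply: (trans _ y) => //; rewrite 1?symE //.
rewrite rold // => ly; have {}Eyz := E'old _ _ yV zV Eyz.
by apply: EVr => //; [exact: (trans _ y)|exact: leq_ltn_trans ly].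
Qed.
End SubdividedSphere.

(** * Repeated subdivision of an edge *)
Lemma split_card (T : finType) (W : {set T}) k l : #|W| = (k + l)%N ->
  exists W1 W2 : {set T}, [/\ W = W1 :|: W2, [disjoint W1 & W2], #|W1| = k & #|W2| = l].
Proof.
move=> cW; pose W1 := [set x in take k (enum W)].
have sub : W1 \subset W.
  by apply/subsetP => x; rewrite inE => /mem_take; rewrite mem_enum.
have c1 : #|W1| = k.
  rewrite cardsE (card_uniqP _) ?take_uniq ?enum_uniq // size_takel //.
  by rewrite -cardE cW leq_addr.
exists W1, (W :\: W1); split=> //.
- by rewrite -{1}(setID W W1) (setIidPr sub).
- by rewrite disjoints_subset setDE setCI setCK subsetUr.
- by rewrite cardsD (setIidPr sub) cW c1 addKn.
Qed.

(** After one subdivision the edge pq' plays the role that pp' had: for old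
    vertices it has the same common neighbours, and its link is the same. *)
Section OneStep.
Variables (T : finType) (V : {set T}) (E : rel T) (r : T -> nat) (d : nat) (p p' q q' : T).
Hypotheses (hV : ranked_sphere V E r d) (Epp' : E p p') (rpp' : r p' = (r p).+1).
Hypotheses (qq' : q != q') (qV : q \notin V) (q'V : q' \notin V).
Local Notation E' := (subdivide E p p' q q').
Local Notation V' := (q |: (q' |: V)).

Let symE := sphere_sym hV.
Let irrE := sphere_irr hV.
Let isoq := sphere_isolated hV qV.
Let isoq' := sphere_isolated hV q'V.
Let pV : p \in V := sphere_suppl hV Epp'.
Let p'V : p' \in V := sphere_suppr hV Epp'.
Let npq := neq_pq symE irrE Epp' isoq isoq'.

Lemma new_edge_common x : x \in V ->
  E' p x && E' q' x = E p x && E p' x.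
Proof.
have [pp' pq pq' p'q p'q'] := npq.
move=> xV; rewrite (subdivide_J E p p' qV q'V) // subdivide_q' // eqxx (negbTE pp') /= orbF.
have /andP[/negbTE-> _] := notin_neq2 qV q'V xV.
case: (eqVneq x p) => [->|_]; first by rewrite irrE.
by case: (eqVneq x p') => [->|_]; rewrite ?irrE ?andbF //= andbT andbA andbb.
Qed.

Lemma all_new_edge s : {subset s <= V} ->
  all (E' p) s && all (E' q') s = all (E p) s && all (E p') s.
Proof.
move=> sV; have allC (F G : pred T) : all F s && all G s = all (fun x => F x && G x) s.
  by elim: (s) => //= x s' <-; rewrite andbACA.
by rewrite !allC; apply: eq_in_all => x /sV /new_edge_common.
Qed.

Lemma hpoly_link_new_edge s m : {subset s <= V} -> all (E p) s -> all (E p') s ->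
  hpoly E' (link E' V' [:: q', p & s]) m = hpoly E (link E V [:: p', p & s]) m.
Proof.
have [pp' pq pq' p'q p'q'] := npq.
have symE' := subdivide_sym symE irrE Epp' qq' isoq isoq'.
have irrE' := subdivide_irr symE irrE Epp' qq' isoq isoq'.
move=> sV sp sp'.
have -> : link E' V' [:: q', p & s] = link E V [:: p', p & s].
  apply/setP => y; rewrite !in_link /= ![in LHS]inE.
  case: (eqVneq y q) => [->|yq] /=.
    by rewrite (negbTE qV) [E' p q]symE' subdivide_q (negbTE pq') (negbTE pp') irrE andbF.
  case: (eqVneq y q') => [->|yq'] /=; first by rewrite (negbTE q'V) irrE'.
  case: (boolP (y \in V)) => //= yV; rewrite !andbA.
  rewrite [E' q' y && _]andbC [E p' y && _]andbC new_edge_common //; congr (_ && _).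
  apply: eq_in_all => x xs; have xV := sV x xs.
  have xp : x != p by apply: contraTneq (allP sp x xs) => ->; rewrite irrE.
  have xp' : x != p' by apply: contraTneq (allP sp' x xs) => ->; rewrite irrE.
  by rewrite (subdivide_J E p p' qV q'V) // (negbTE xp) (negbTE xp') andbT.
apply/esym/eq_hpoly => x y; rewrite !in_link /= => /and4P[xV Ex' Ex _] /and4P[yV Ey' Ey _].
have xp : x != p by apply: contraTneq Ex => ->; rewrite irrE.
have xp' : x != p' by apply: contraTneq Ex' => ->; rewrite irrE.
by rewrite (subdivide_J E p p' qV q'V) // (negbTE xp) (negbTE xp') andbT.
Qed.
End OneStep.

(** The vertices to be added are drawn from a set W given in advance, since the
    orientations, hence the notion of acyclicity, depend on the whole type T.  A
    subdivided edge pp' is subdivided again at pq', whose link is that of pp'. *)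
Lemma ranked_sphere_subdivide_iter (T : finType) n (V W : {set T}) E r d p p' :
    ranked_sphere V E r d -> E p p' -> r p' = (r p).+1 ->
    [disjoint V & W] -> #|W| = (n.+1).*2 ->
  exists E' r', [/\ ranked_sphere (V :|: W) E' r' d, {in V, r' =1 r},
    {in V &, forall x y, E' x y =
       E x y && ~~ ((x == p) && (y == p') || (x == p') && (y == p))} &
    forall s, {subset s <= V} -> pairwise E' s ->
      hpoly E' (link E' (V :|: W) s) (d - size s) =
        hpoly E (link E V s) (d - size s) +
        (if all (E p) s && all (E p') s then
           (n.+1).*2%:R *: 'X * hpoly E (link E V [:: p', p & s]) (d - size s - 2)
         else 0)].
Proof.
elim: n V W E r p' => [|n IHn] V W E r p' hV Epp' rpp' dVW cW;
  have symE := sphere_sym hV; have irrE := sphere_irr hV.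
- have /cards2P[q [q' [qq' WE]]] : #|W| == 2 by rewrite cW.
  have qV : q \notin V.
    by apply/negP => /(disjointFr dVW); rewrite WE !inE eqxx.
  have q'V : q' \notin V.
    by apply/negP => /(disjointFr dVW); rewrite WE !inE eqxx orbT.
  have -> : V :|: W = q |: (q' |: V) by rewrite WE setUC setUA.
  exists (subdivide E p p' q q'), (new_rank r p p' q q'); split.
  + exact: ranked_sphere_subdivide.
  + by move=> x xV; have /andP[/negbTE xq /negbTE xq'] := notin_neq2 qV q'V xV;
      rewrite /new_rank xq xq'.
  + by move=> x y xV yV; exact: (subdivide_J E p p' qV q'V).
  move=> s sV Us; apply: hpoly_link_subdivide => //.
  + exact: (sphere_isolated hV qV).
  + exact: (sphere_isolated hV q'V).
  + exact: (sphere_suppl hV Epp').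
  + exact: (sphere_suppr hV Epp').
  apply: hsphere_link => //; first exact: sphere_hsphere hV.
  by apply: (sub_in_pairwise (P := mem V)) Us; [exact: (sub_subdivide qV q'V)|exact/allP].
have [Q [W0 [WE dQW0 cQ cW0]]] := @split_card _ W 2 (n.+1).*2 cW.
have /cards2P[q [q' [qq' QE]]] : #|Q| == 2 by rewrite cQ.
have qV : q \notin V.
  by apply/negP => /(disjointFr dVW); rewrite WE QE !inE eqxx.
have q'V : q' \notin V.
  by apply/negP => /(disjointFr dVW); rewrite WE QE !inE eqxx orbT.
have [pV p'V] : p \in V /\ p' \in V.
  by split; [exact: (sphere_suppl hV Epp')|exact: (sphere_suppr hV Epp')].
have isoq := sphere_isolated hV qV; have isoq' := sphere_isolated hV q'V.
have [pp' pq pq' p'q p'q'] := neq_pq symE irrE Epp' isoq isoq'.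
have hV1 := ranked_sphere_subdivide hV Epp' rpp' qq' qV q'V.
set V1 := q |: (q' |: V) in hV1; set E1 := subdivide E p p' q q' in hV1.
have r1 x : x \in V -> new_rank r p p' q q' x = r x.
  by move=> xV; have /andP[/negbTE xq /negbTE xq'] := notin_neq2 qV q'V xV;
      rewrite /new_rank xq xq'.
have VWE : V :|: W = V1 :|: W0.
  by rewrite WE QE /V1 setUA [V :|: _]setUC -!setUA.
have dV1 : [disjoint V1 & W0].
  rewrite disjoint_sym; apply/pred0P => x /=; rewrite !inE; apply/negP.
  case/andP => xW0 /or3P[/eqP xq|/eqP xq'|xV].
  - by have := disjointFl dQW0 xW0; rewrite QE xq !inE eqxx.
  - by have := disjointFl dQW0 xW0; rewrite QE xq' !inE eqxx orbT.
  - by have := disjointFr dVW xV; rewrite WE inE xW0 orbT.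
have E1pq' : E1 p q'.
  by rewrite /E1 (subdivide_sym symE irrE Epp' qq' isoq isoq') subdivide_q' // eqxx orbT.
have r1q' : new_rank r p p' q q' q' = (new_rank r p p' q q' p).+1.
  by rewrite [in RHS]r1 // /new_rank [q' == q]eq_sym (negbTE qq') eqxx.
have [E2 [r2 [hV2 r2E E2E hs2]]] := IHn V1 W0 E1 _ q' hV1 E1pq' r1q' dV1 cW0.
have sVV1 : {subset V <= V1} by move=> x xV; rewrite !inE xV !orbT.
exists E2, r2; rewrite VWE; split=> //.
- by move=> x xV; rewrite r2E ?r1 // sVV1.
- move=> x y xV yV; rewrite E2E ?sVV1 // /E1 (subdivide_J E p p' qV q'V) //.
  have /andP[_ /negbTE xq'] := notin_neq2 qV q'V xV;
      have /andP[_ /negbTE yq'] := notin_neq2 qV q'V yV.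
  by rewrite xq' yq' andbF andbT.
move=> s sV Us2; have sV1 : {subset s <= V1} by move=> x /sV /sVV1.
have Us1 : pairwise E1 s.
  apply: (sub_in_pairwise (P := mem V1)) Us2; last exact/allP.
  by move=> x y xV yV; rewrite E2E // => /andP[].
have Us : pairwise E s.
  by apply: (sub_in_pairwise (P := mem V)) Us1; [exact: (sub_subdivide qV q'V)|exact/allP].
rewrite hs2 // /V1 /E1 hpoly_link_subdivide //; last first.
  by apply: hsphere_link => //; exact: sphere_hsphere hV.
rewrite (all_new_edge hV Epp' qq' qV q'V sV).
case: ifP => [/andP[sp sp']|_]; last by rewrite !addr0.
rewrite (hpoly_link_new_edge hV Epp' qq' qV q'V) // -addrA -mulrDl -scalerDl -natrD.
by congr (_ + _ %:R *: _ * _).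
Qed.

(** * The ordinal sum of antichains and its subdivisions *)

(** The comparability graph of the ordinal sum of d antichains with two elements,
    which is the boundary of a cross-polytope: an iterated suspension. *)
Section CrossSphere.
Variables (d : nat) (T : finType) (emb : 'I_d * bool -> T).
Hypothesis emb_inj : injective emb.
Implicit Types (a b : 'I_d * bool).

Definition cross_rel : rel T := fun x y =>
  [exists a, exists b, [&& emb a == x, emb b == y & a.1 != b.1]].

Definition cross_rank (x : T) : nat :=
  if [pick a | emb a == x] is Some a then (a.1 : nat).+1 else 0.

Definition cross_part (S : {set 'I_d}) : {set T} := [set emb a | a in [pred a | a.1 \in S]].

Lemma cross_relP x y :
  reflect (exists a b, [/\ emb a = x, emb b = y & a.1 != b.1]) (cross_rel x y).
Proof.
apply: (iffP existsP) => [[a /existsP[b /and3P[/eqP ? /eqP ? ?]]]|[a [b [<- <- ab]]]].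
  by exists a, b.
by exists a; apply/existsP; exists b; rewrite !eqxx.
Qed.

Lemma cross_relE a b : cross_rel (emb a) (emb b) = (a.1 != b.1).
Proof.
apply/cross_relP/idP => [[a' [b' [/emb_inj-> /emb_inj-> //]]]|ab].
by exists a, b.
Qed.

Lemma cross_rankE a : cross_rank (emb a) = (a.1 : nat).+1.
Proof.
rewrite /cross_rank; case: pickP => [b /eqP/emb_inj-> //|/(_ a)].
by rewrite eqxx.
Qed.

Lemma cross_sym : symmetric cross_rel.
Proof.
move=> x y; apply/cross_relP/cross_relP => -[a [b [<- <- ab]]];
  by exists b, a; rewrite eq_sym.
Qed.

Lemma cross_irr : irreflexive cross_rel.
Proof. by move=> x; apply/cross_relP => -[a [b [<- /emb_inj->]]]; rewrite eqxx. Qed.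

Lemma in_cross_part S a : (emb a \in cross_part S) = (a.1 \in S).
Proof. by rewrite mem_imset. Qed.

Lemma cross_partP S x : x \in cross_part S -> exists2 a, x = emb a & a.1 \in S.
Proof. by case/imsetP => a; exists a. Qed.

Lemma hpoly_set0 (E : rel T) m : hpoly E set0 m = ('X - 1) ^+ m.
Proof.
rewrite /hpoly (big_pred1 set0) ?cards0 ?subn0 // => A.
apply/idP/eqP => [/cliqueP[sA _]|->]; last exact: clique0.
by apply/setP => x; rewrite inE; apply/negP => /sA; rewrite inE.
Qed.

Lemma hsphere_cross_part S :
  hsphere cross_rel (cross_part S) #|S| /\
  hpoly cross_rel (cross_part S) #|S| = ('X + 1) ^+ #|S|.
Proof.
move: {2}#|S| (leqnn #|S|) => m; elim: m S => [|m IHm] S.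
  rewrite leqn0 cards_eq0 => /eqP->; rewrite cards0.
  have -> : cross_part set0 = set0.
    by apply/setP => x; rewrite inE; apply/negP => /cross_partP[a _]; rewrite inE.
  rewrite hpoly_set0 !expr0; split=> //; split=> //; split.
  - by move=> A /cliqueP[sA _]; rewrite leqn0 cards_eq0; apply/eqP/setP => x;
      rewrite inE; apply/negP => /sA; rewrite inE.
  - exact: acyclic0.
  - by rewrite hpoly_set0 expr0 coef1.
case: (set_0Vmem S) => [->|[i iS]]; first by rewrite cards0 => _; have := IHm set0;
    rewrite cards0; apply.
rewrite (cardsD1 i) iS ltnS => /IHm[hg hs]; rewrite exprS -hs.
have -> : cross_part S = emb (i, true) |: (emb (i, false) |: cross_part (S :\ i)).
  apply/setP => x; rewrite !inE; apply/idP/or3P => [/cross_partP[[j b] -> /= jS]|].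
    case: (eqVneq j i) => [->|ji]; last by constructor 3; rewrite in_cross_part !inE ji.
    by case: b; [constructor 1|constructor 2].
  case=> [/eqP->|/eqP->|/cross_partP[a -> ]]; rewrite in_cross_part //.
  by rewrite !inE => /andP[].
have n1 (c : bool) : emb (i,
    c) \notin cross_part (S :\ i) by rewrite in_cross_part !inE eqxx.
have n2 : emb (i, true) != emb (i, false) by rewrite (inj_eq emb_inj) xpair_eqE andbF.
have n3 : ~~ cross_rel (emb (i, true)) (emb (i, false)) by rewrite cross_relE eqxx.
have n4 (c : bool) : {in cross_part (S :\ i), forall z, cross_rel (emb (i, c)) z}.
  by move=> z /cross_partP[a ->]; rewrite cross_relE !inE eq_sym => /andP[].
split; last first.
  apply: hpoly_susp => //; [exact: cross_sym|exact: cross_irr|exact: hsphere_spherical].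
by apply: hsphere_susp => //; [exact: cross_sym|exact: cross_irr].
Qed.

Lemma ranked_sphere_cross : ranked_sphere (cross_part setT) cross_rel cross_rank d.
Proof.
split.
- exact: cross_sym.
- exact: cross_irr.
- by move=> x y /cross_relP[a [b [<- _ _]]]; rewrite in_cross_part inE.
- by have := proj1 (hsphere_cross_part setT); rewrite cardsT card_ord.
- by move=> x /cross_partP[a -> _]; rewrite cross_rankE /= ltn_ord.
- by move=> x y /cross_relP[a [b [<- <- ab]]]; rewrite !cross_rankE eqSS.
- move=> x y z /cross_relP[a [b [<- <- ab]]] /cross_relP[b' [c [/emb_inj-> <- bc]]].
  rewrite !cross_rankE cross_relE => lab lbc; apply: contraTneq (ltn_trans lab lbc) => ->.
  by rewrite ltnn.
Qed.

Lemma link_cross (s : seq ('I_d * bool)) :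
  link cross_rel (cross_part setT) (map emb s) = cross_part (~: [set i in map fst s]).
Proof.
apply/setP => y; rewrite in_link;
    apply/andP/idP => [[/cross_partP[a -> _]]|/cross_partP[a ->]].
  rewrite in_cross_part !inE all_map => /allP h; apply/mapP => -[b bs ab].
  by have := h b bs; rewrite /= cross_relE ab eqxx.
rewrite !inE => ns; rewrite in_cross_part inE; split=> //; rewrite all_map.
apply/allP => b bs /=; rewrite cross_relE; apply: contraNneq ns => <-.
exact: map_f.
Qed.

Lemma hpoly_link_cross (s : seq ('I_d * bool)) : uniq (map fst s) ->
  hpoly cross_rel (link cross_rel (cross_part setT) (map emb s)) (d - size s)
    = ('X + 1) ^+ (d - size s).
Proof.
move=> Us; rewrite link_cross; have := proj2 (hsphere_cross_part (~: [set i in map fst s])).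
have -> // : #|~: [set i in map fst s]| = (d - size s)%N.
by rewrite cardsCs setCK card_ord cardsE (card_uniqP Us) size_map.
Qed.
End CrossSphere.

Section Programs.
Variable d : nat.
Local Notation label := ('I_d * bool)%type.
Implicit Types (a b : label) (s : seq label) (ops : seq (label * label * nat)).

(** Adjacency of the original vertices once the edges in R have been subdivided. *)
Definition label_adj (R : seq (label * label)) : rel label :=
  fun a b => [&& a.1 != b.1, (a, b) \notin R & (b, a) \notin R].

(** The h-polynomial of the link of s after the subdivisions in ops, the last one
    at the head of the list.  It is defined on labels, hence can be evaluated
    without any knowledge of the new vertices. *)
Fixpoint ops_hpoly ops s : {poly int} :=
  if ops is (e, n) :: ops' then
    ops_hpoly ops' s +
    (if all (label_adj (map fst ops') e.1) s && all (label_adj (map fst ops') e.2) s then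
       n.*2%:R *: 'X * ops_hpoly ops' [:: e.2, e.1 & s]
     else 0)
  else ('X + 1) ^+ (d - size s).

Fixpoint valid_ops ops : bool :=
  if ops is (e, n) :: ops' then
    [&& label_adj (map fst ops') e.1 e.2, (e.2.1 : nat) == e.1.1.+1,
        (0 < n)%N & valid_ops ops']
  else true.

Lemma adj_sym R : symmetric (label_adj R).
Proof. by move=> a b; rewrite /label_adj eq_sym [X in _ && X]andbC. Qed.

Lemma adj_cons e R a b : label_adj (e :: R) a b =
  label_adj R a b && ~~ ((a == e.1) && (b == e.2) || (a == e.2) && (b == e.1)).
Proof.
case: e => e1 e2; rewrite /label_adj !inE !negb_or !xpair_eqE /=.
by case: (_ != _); case: (_ \in R); case: (_ \in R); case: (a == e1); case: (b == e2);
    case: (a == e2); case: (b == e1).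
Qed.

Definition vertices_added ops : nat := \sum_(o <- ops) o.2.*2.

Lemma ops_ranked_sphere (T : finType) (emb : label -> T) (W : {set T}) ops :
    injective emb -> valid_ops ops ->
    [disjoint cross_part emb setT & W] -> #|W| = vertices_added ops ->
  exists E r, [/\ ranked_sphere (cross_part emb setT :|: W) E r d,
    forall a, r (emb a) = (a.1 : nat).+1,
    forall a b, E (emb a) (emb b) = label_adj (map fst ops) a b &
    forall s, pairwise (label_adj (map fst ops)) s ->
      hpoly E (link E (cross_part emb setT :|: W) (map emb s)) (d - size s) = ops_hpoly
          ops s].
Proof.
move=> emb_inj; elim: ops W => [|[[a b] [|n]] ops IH] W /=; rewrite ?andbF //.
  move=> _ _; rewrite /vertices_added big_nil => /eqP; rewrite cards_eq0 => /eqP->.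
  rewrite setU0; exists (cross_rel emb), (cross_rank emb); split.
  - exact: ranked_sphere_cross.
  - exact: cross_rankE.
  - by move=> a b; rewrite cross_relE // /label_adj andbT.
  move=> s Us; apply: hpoly_link_cross => //.
  rewrite uniq_pairwise pairwise_map; apply: sub_pairwise Us => a b.
  by rewrite /label_adj /= => /andP[].
case/and3P => Eab /eqP rab vops dW;
    rewrite /vertices_added big_cons -/(vertices_added ops) /= addnC => cW.
have [W1 [W2 [WE dW12 cW1 cW2]]] := split_card cW.
set V0 := cross_part emb setT in dW *.
have dW1 : [disjoint V0 & W1] by apply: disjointWr dW; rewrite WE subsetUl.
have [E [r [hV rE EE hE]]] := IH W1 vops dW1 cW1.
have Eab' : E (emb a) (emb b) by rewrite EE.
have rab' : r (emb b) = (r (emb a)).+1 by rewrite !rE rab.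
have dV : [disjoint V0 :|: W1 & W2].
  rewrite disjoint_sym disjoints_subset setCU subsetI -!disjoints_subset.
  rewrite ![[disjoint W2 & _]]disjoint_sym dW12 andbT.
  by apply: disjointWr dW; rewrite WE subsetUr.
have [E' [r' [hV' r'E E'E hE']]] := ranked_sphere_subdivide_iter hV Eab' rab' dV cW2.
have embV x : emb x \in V0 :|: W1 by rewrite inE in_cross_part // inE.
have E'adj x y : E' (emb x) (emb y) = label_adj ((a, b) :: map fst ops) x y.
  by rewrite E'E // EE adj_cons /= !(inj_eq emb_inj).
rewrite WE setUA; exists E', r'; split=> //; first by move=> x; rewrite r'E.
move=> s Us; rewrite -(size_map emb) hE'; last first.
- by rewrite pairwise_map; apply: sub_pairwise Us => x y; rewrite -E'adj.
- by move=> x /mapP[y _ ->].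
have Us' : pairwise (label_adj (map fst ops)) s.
  by apply: sub_pairwise Us => x y; rewrite adj_cons => /andP[].
rewrite size_map hE // !all_map.
have allE x : all (preim emb (E (emb x))) s = all (label_adj (map fst ops) x) s.
  by apply: eq_all => y /=; rewrite EE.
rewrite !allE; case: ifP => // /andP[sa sb]; congr (_ + _ * _).
rewrite -subnDA addn2; apply: (hE [:: b, a & s]).
by rewrite /= Us' sa sb !andbT adj_sym.
Qed.
End Programs.

Section Comparability.
Variables (disp : Order.disp_t) (P : finTBPOrderType disp).
Implicit Types (s t x y : P) (J C : {set P}).

(** * From ranks and vanishing homology to the poset conditions *)

(** The comparability graph. *)
Definition strict_cmp : rel P := fun x y => (x != y) && (x >=< y)%O.

Lemma strict_cmp_sym : symmetric strict_cmp.
Proof. by move=> x y; rewrite /strict_cmp eq_sym comparable_sym. Qed.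

Lemma is_chainP C : reflect {in C &, forall x y, (x >=< y)%O} (is_chain C).
Proof.
apply: (iffP forall_inP) => [h x y xC yC|h x xC]; first exact: (forall_inP (h x xC)).
by apply/forall_inP => y yC; exact: h.
Qed.

Lemma order_complex_clique J C : (C \in order_complex J) = clique strict_cmp J C.
Proof.
rewrite inE; apply/andP/cliqueP => [[/is_chainP h /subsetP sC]|[sC h]]; split=> //.
- by move=> x y xC yC xy; rewrite /strict_cmp xy h.
- apply/is_chainP => x y xC yC; case: (eqVneq x y) => [->|xy]; first exact: comparablexx.
  by have /andP[] := h x y xC yC xy.
- exact/subsetP.
Qed.

Lemma homology_acyclic J m : acyclic strict_cmp J m -> bounded strict_cmp J m ->
  homology_below_top_zero J.
Proof.
move=> ha hb i lti c hc bc.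
have dimD : complex_dim (order_complex J) <= m%:Z - 1.
  rewrite /complex_dim lerD2r lez_nat; apply/bigmax_leqP => A.
  by rewrite order_complex_clique => /hb.
case: (leP 0 (i + 1)) => i1; last first.
  have c0 : c = 0.
    apply/ffunP => A; rewrite [RHS]ffunE; apply/eqP; apply: contraTT i1 => /hc[_ <-].
    by rewrite /simplex_dim subrK -leNgt.
  exists 0; last by rewrite c0 raddf0.
  by move=> A; rewrite ffunE eqxx.
have [n En] : exists n : nat, i = n%:Z - 1.
  by exists (absz (i + 1)); rewrite gez0_abs // addrK.
have hc' : chain_on strict_cmp J n c.
  move=> A /hc[]; rewrite order_complex_clique => hA; rewrite /simplex_dim En => /addIr[->].
  by split.
have [|e he be] := ha n _ c hc' bc; first by move: lti dimD; rewrite En; lia.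
exists e => // A /he[hA cA]; rewrite order_complex_clique; split=> //.
by rewrite /simplex_dim cA En; lia.
Qed.

Lemma homology_cone J x : x \in J -> (forall y, y \in J -> y != x -> strict_cmp x y) ->
  homology_below_top_zero J.
Proof.
move=> xJ hx; apply: (@homology_acyclic _ #|P|); last by move=> A _; exact: max_card.
by apply: (@acyclic_cone _ _ _ x) => //; exact: strict_cmp_sym.
Qed.

Definition open_itv s t : {set P} := [set x | (s < x < t)%O].

(** As P is bounded, the sets of all elements below t and of all elements above s
    have cones as order complexes; only open intervals matter. *)
Lemma homology_lower t : (\bot < t)%O -> homology_below_top_zero [set x : P | (x < t)%O].
Proof.
move=> ht; apply: (@homology_cone _ \bot%O); first by rewrite inE.
by move=> y _ yb; rewrite /strict_cmp eq_sym yb comparable_sym /Order.comparable le0x orbT.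
Qed.

Lemma homology_upper s : (s < \top)%O -> homology_below_top_zero [set x : P | (s < x)%O].
Proof.
move=> hs; apply: (@homology_cone _ \top%O); first by rewrite inE.
by move=> y _ yb; rewrite /strict_cmp eq_sym yb /Order.comparable lex1 orbT.
Qed.

Section Ranked.
Variable rk : P -> nat.
Hypothesis rk_lt : forall x y, (x < y)%O -> (rk x < rk y)%N.

Lemma rk_le x y : (x <= y)%O -> (rk x <= rk y)%N.
Proof. by rewrite le_eqVlt => /predU1P[->//|/rk_lt/ltnW]. Qed.

Lemma rk_strict_cmp x y : strict_cmp x y -> rk x != rk y.
Proof.
rewrite /strict_cmp /Order.comparable neq_ltn => /andP[xy /orP[]]; rewrite le_eqVlt.
  by rewrite (negbTE xy) => /rk_lt->.
by rewrite eq_sym (negbTE xy) => /rk_lt->; rewrite orbT.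
Qed.

Lemma rk_inj J C : clique strict_cmp J C -> {in C &, injective rk}.
Proof.
move=> /cliqueP[_ hC] x y xC yC e; apply/eqP; apply: contraT => xy.
by have := rk_strict_cmp (hC x y xC yC xy); rewrite e eqxx.
Qed.

Lemma card_clique_open_itv s t A : clique strict_cmp (open_itv s t) A -> (#|A| <= (rk t -
    rk s).-1)%N.
Proof.
move=> hA; have inj := rk_inj hA; case/cliqueP: hA => sA _.
rewrite cardE -(size_map rk) -(size_iota (rk s).+1 (rk t - rk s).-1).
apply: uniq_leq_size.
  by rewrite map_inj_in_uniq ?enum_uniq // => x y; rewrite !mem_enum; exact: inj.
move=> k /mapP[x]; rewrite mem_enum => /sA; rewrite inE => /andP[/rk_lt sx /rk_lt xt] ->.
by rewrite mem_iota sx /=; lia.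
Qed.

Definition open_hpoly s t : {poly int} :=
  if s == t then 1 else hpoly strict_cmp (open_itv s t) (rk t - rk s).-1.

(** Sorting the nonempty chains of the open interval by their minimum w gives the
    recursion that defines the inverse of [eps_bar]; the summand w = t accounts
    for the empty chain. *)
Lemma open_hpoly_rec s t : (s < t)%O ->
  open_hpoly s t =
    \sum_(w | (s < w <= t)%O) ('X - 1) ^+ (rk w - rk s).-1 * open_hpoly w t.
Proof.
move=> st; rewrite {1}/open_hpoly (lt_eqF st) /hpoly.
rewrite (bigD1 t) ?st ?lexx //= /open_hpoly eqxx mulr1.
rewrite (bigD1 set0) ?clique0 //= cards0 subn0; congr (_ + _).
pose mn w (A : {set P}) := (w \in A) && [forall x in A, (w <= x)%O].
have mn1 (A : {set P}) (F : {poly int}) : clique strict_cmp (open_itv s t) A -> A != set0 ->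
    F = \sum_(w | (s < w <= t)%O && (w != t)) (if mn w A then F else 0).
  move=> /cliqueP[sA hA] /set0Pn[x0 x0A].
  have [w wA' wmin] := arg_minnP rk x0A; have wA : w \in A by [].
  have wle x : x \in A -> (w <= x)%O.
    move=> xA; case: (eqVneq w x) => [->//|wx].
    have /andP[_ /orP[//|]] := hA w x wA xA wx.
    rewrite le_eqVlt eq_sym (negbTE wx) /= => /rk_lt; by rewrite ltnNge wmin.
  have := sA w wA; rewrite inE => /andP[sw wt].
  rewrite (bigD1 w) /=; last by rewrite sw (ltW wt) (lt_eqF wt).
  rewrite /mn wA ifT; last by apply/forall_inP.
  rewrite big1 ?addr0 // => v /andP[_ vw]; rewrite ifF //.
  apply/negbTE/negP => /andP[vA /forall_inP/(_ w wA) vlew].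
  by move/eqP: vw; apply; apply: le_anti; rewrite vlew wle.
rewrite (eq_bigr _ (fun A hA => mn1 A _ (proj1 (andP hA)) (proj2 (andP hA)))).
rewrite exchange_big /=; apply: eq_bigr => w /andP[/andP[sw wt] wnt].
have {wt} wt : (w < t)%O by rewrite lt_neqAle wnt.
rewrite (negbTE wnt) /hpoly mulr_sumr -big_mkcondr /=.
rewrite (reindex_onto (fun B => w |: B) (fun A => A :\ w)) /=; last first.
  by move=> A /andP[_ /andP[wA _]]; rewrite setD1K.
have wn : w \notin open_itv w t by rewrite inE ltxx.
have cond B : (clique strict_cmp (open_itv s t) (w |: B) && (w |: B != set0) && mn w (w
    |: B))
    && ((w |: B) :\ w == B) = clique strict_cmp (open_itv w t) B.
  apply/idP/idP.
    case/andP=> /andP[/andP[/cliqueP[sB hB] _] /andP[_ /forall_inP wmin]] /eqP wB.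
    have wnB : w \notin B by rewrite -wB setD11.
    apply/cliqueP; split=> [x xB|x y xB yB]; last by apply: hB; rewrite inE ?xB ?yB orbT.
    have := sB x; rewrite !inE xB orbT => /(_ isT)/andP[_ ->].
    rewrite andbT lt_neqAle wmin ?inE ?xB ?orbT // andbT.
    by apply: contraNneq wnB => ->.
  move=> hB; have wnB : w \notin B.
    by apply: contra wn; case/cliqueP: hB => sB _; exact: sB.
  have ltw x : x \in B -> (w < x < t)%O by case/cliqueP: hB => sB _ /sB; rewrite inE.
  rewrite setU1K // eqxx andbT -andbA; apply/and3P; split.
  - apply/cliqueP; split=> [x|x y].
      case/setU1P => [->|/ltw/andP[wx xt]]; first by rewrite inE sw.
      by rewrite inE (lt_trans sw wx).
    case/setU1P => [->|xB]; case/setU1P => [->|yB] xy.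
    + by rewrite eqxx in xy.
    + by have /andP[wy _] := ltw y yB; rewrite /strict_cmp xy /Order.comparable (ltW wy).
    + by have /andP[wx _] := ltw x xB;
        rewrite /strict_cmp xy /Order.comparable (ltW wx) orbT.
    + by case/cliqueP: hB => _; apply.
  - by apply/set0Pn; exists w; rewrite setU11.
  - rewrite /mn setU11; apply/forall_inP => x /setU1P[->//|/ltw/andP[/ltW]] //.
apply: eq_big => [B|B]; rewrite cond // => hc; have wnB : w \notin B.
  by apply: contra wn; case/cliqueP: hc => sB _; exact: sB.
rewrite cardsU1 wnB -exprD; congr (_ ^+ _).
move: (card_clique_open_itv hc) (rk_lt sw) (rk_lt wt).
by move: (rk s) (rk w) (rk t) #|B| => a b c k; rewrite add1n; clear; lia.
Qed.
End Ranked.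
End Comparability.

Arguments strict_cmp {disp P}.

(** A flag meets every rank exactly once, so counting its elements under a
    condition on ranks is counting ranks. *)
Lemma full_rank_card (T : finType) (f : T -> nat) n (F : {set T}) (Q : pred nat) :
  {in F &, injective f} -> (forall x, x \in F -> (f x < n)%N) -> #|F| = n ->
  #|[set x in F | Q (f x)]| = count Q (iota 0 n).
Proof.
move=> inj lt_n cF.
have Uf : uniq (map f (enum F)).
  by rewrite map_inj_in_uniq ?enum_uniq // => x y; rewrite !mem_enum; exact: inj.
have sub : {subset map f (enum F) <= iota 0 n}.
  by move=> k /mapP[x]; rewrite mem_enum => /lt_n xn ->; rewrite mem_iota.
have sz : (size (iota 0 n) <= size (map f (enum F)))%N.
  by rewrite size_iota size_map -cardE cF.
have [_ eqi] := uniq_min_size Uf sub sz.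
have pe : perm_eq (map f (enum F)) (iota 0 n).
  by apply: uniq_perm => //; exact: iota_uniq.
rewrite -(permP pe) count_map -size_filter cardE.
apply: perm_size; apply: uniq_perm => [||x]; [exact: enum_uniq|by apply: filter_uniq;
    exact: enum_uniq|].
by rewrite mem_enum inE [RHS]mem_filter mem_enum /= andbC.
Qed.

Lemma full_rank_onto (T : finType) (f : T -> nat) n (F : {set T}) k :
  {in F &, injective f} -> (forall x, x \in F -> (f x < n)%N) -> #|F| = n ->
  (k < n)%N -> exists2 x, x \in F & f x = k.
Proof.
move=> inj lt_n cF kn; have := full_rank_card (pred1 k) inj lt_n cF.
rewrite count_uniq_mem ?iota_uniq // mem_iota kn => /eqP; rewrite eqn_leq => /andP[_].
by case/card_gt0P => x; rewrite inE => /andP[xF /eqP fx]; exists x.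
Qed.

Lemma count_iota_outside a b n : (a < b <= n)%N ->
  count (fun k => [&& 0 < k, k < n & (k <= a) || (b <= k)])%N (iota 0 n.+1)
    = (n - (b - a).-1).-1.
Proof.
case/andP=> ab bn.
set Q := (fun k => _).
have cT m l : (forall i, (m <= i < m + l)%N -> Q i) -> count Q (iota m l) = l.
  move=> h; apply/eqP; rewrite -[X in _ == X](size_iota m) -all_count; apply/allP => i.
  by rewrite mem_iota; exact: h.
have cF m l : (forall i, (m <= i < m + l)%N -> Q i = false) -> count Q (iota m l) = 0.
  move=> h; rewrite (@eq_in_count _ _ pred0) ?count_pred0 // => i; rewrite mem_iota;
      exact: h.
have -> : (n.+1 = 1 + (a + ((b - a).-1 + ((n - b) + 1))))%N by move: ab bn; clear; lia.
rewrite !iotaD !count_cat cF; first (rewrite cT; first (rewrite cF; first (rewrite cT;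
    first (rewrite cF; first by move: ab bn; clear; lia)))).
all: by move=> i; rewrite /Q; move: ab bn; clear; lia.
Qed.

Lemma count_iota_leq k n : (k < n)%N -> count (fun i => i <= k)%N (iota 0 n) = k.+1.
Proof.
move=> kn; rewrite -(subnKC kn) iotaD count_cat.
have /eqP-> : count (fun i => i <= k)%N (iota 0 k.+1) == k.+1.
  by rewrite -[X in _ == X](size_iota 0) -all_count; apply/allP => i; rewrite mem_iota.
rewrite (@eq_in_count _ _ pred0) ?count_pred0 ?addn0 // => i.
by rewrite mem_iota add0n => /andP[ki _]; rewrite leqNgt ki.
Qed.

(** Flags of full length make P graded with rank function rk; spherical open
    intervals then give everything else. *)
Section Certificate.
Variables (disp : Order.disp_t) (P : finTBPOrderType disp) (rk : P -> nat) (d : nat).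
Implicit Types (s t x y : P) (C : {set P}).
Hypothesis rk_lt : forall x y, (x < y)%O -> (rk x < rk y)%N.
Hypothesis rk_max : forall x, (rk x <= d.+1)%N.
Hypothesis flags : forall C, is_chain C ->
  exists F, [/\ is_chain F, C \subset F & #|F| = d.+2].

Lemma is_chain_clique C : is_chain C = clique strict_cmp setT C.
Proof. by rewrite -order_complex_clique inE subsetT andbT. Qed.

Lemma chain_rk_inj C : is_chain C -> {in C &, injective rk}.
Proof. by rewrite is_chain_clique; exact: rk_inj. Qed.

Lemma graded_of_flags : graded P.
Proof.
suff h C : maximal_chain C -> #|C| = d.+2 by move=> C D /h-> /h->.
case/maxsetP => hC maxC; have [F [hF sF <-]] := flags hC.
by rewrite (maxC F hF sF).
Qed.

Lemma rhoE t : rho t = rk t.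
Proof.
rewrite /rho; set m := \max_(_ | _) _; suff -> : m = (rk t).+1 by [].
apply/eqP; rewrite eqn_leq; apply/andP; split.
  apply/bigmax_leqP => C /andP[hC /forall_inP Ct].
  rewrite cardE -(size_map rk) -(size_iota 0 (rk t).+1); apply: uniq_leq_size.
    rewrite map_inj_in_uniq ?enum_uniq // => x y; rewrite !mem_enum;
        exact: (chain_rk_inj hC).
  move=> k /mapP[x]; rewrite mem_enum => /Ct xt ->.
  by rewrite mem_iota add0n ltnS; exact: rk_le.
have [F [hF tF cF]] : exists F, [/\ is_chain F, [set t] \subset F & #|F| = d.+2].
  by apply: flags; apply/is_chainP => x y /set1P-> /set1P->; exact: comparablexx.
rewrite -(@count_iota_leq _ d.+2) ?ltnS //.
have lt_F x : x \in F -> (rk x < d.+2)%N by rewrite ltnS.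
rewrite -(full_rank_card _ (chain_rk_inj hF) lt_F cF).
have -> : [set x in F | (rk x <= rk t)%N] = [set x in F | (x <= t)%O].
  apply/setP => x; rewrite !inE; case: (boolP (x \in F)) => //= xF.
  have /orP[xt|tx] : (x >=< t)%O.
    by move/is_chainP: hF; apply=> //; rewrite -sub1set.
    by rewrite xt rk_le.
  case: (eqVneq x t) => [->|xt]; first by rewrite lexx leqnn.
  have {}tx : (t < x)%O by rewrite lt_neqAle eq_sym xt.
  by rewrite leqNgt rk_lt // lt_geF.
apply: (@leq_bigmax_cond _ _ (fun C : {set P} => #|C|)); apply/andP; split.
  apply/is_chainP => x y; rewrite !inE => /andP[xF _] /andP[yF _].
  by move/is_chainP: hF; apply.
by apply/forall_inP => x; rewrite inE => /andP[].
Qed.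

Hypothesis sph : forall s t,
    (s < t)%O -> spherical strict_cmp (open_itv s t) (rk t - rk s).-1.

Lemma cohen_macaulay_of_spherical : cohen_macaulay P.
Proof.
move=> s t st; split.
- by have [hb ha _] := sph st; exact: homology_acyclic ha hb.
- by apply: homology_lower; exact: le_lt_trans (le0x s) st.
- by apply: homology_upper; exact: lt_le_trans st (lex1 t).
Qed.

Lemma chow_functionE s t : (s <= t)%O -> chow_function s t = open_hpoly rk s t.
Proof.
move: {2}(rk t - rk s)%N (leqnn (rk t - rk s)) => n; elim: n s => [|n IHn] s ln st.
  have -> : s = t.
    apply/eqP; move: st; rewrite le_eqVlt => /orP[//|/rk_lt]; rewrite -subn_gt0.
    by rewrite ltnNge ln.
  by rewrite /chow_function inc_inv_unfold /open_hpoly !eqxx /eps_bar eqxx invrN1 opprK.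
case: (eqVneq s t) => [->|nst].
  by rewrite /chow_function inc_inv_unfold /open_hpoly !eqxx /eps_bar eqxx invrN1 opprK.
have lst : (s < t)%O by rewrite lt_neqAle nst.
rewrite (open_hpoly_rec rk_lt lst) /chow_function inc_inv_unfold (negbTE nst).
rewrite {1}/eps_bar eqxx invrN1 mulN1r opprK -sumrN.
apply: eq_bigr => w /andP[sw wt].
rewrite -mulrN -/(chow_function w t) IHn //; last first.
  by have := rk_lt sw; have := rk_le rk_lt wt; move: ln; clear; lia.
by rewrite /eps_bar (lt_eqF sw) /rho_int !rhoE.
Qed.

Lemma open_hpoly_coef0 s t : (s <= t)%O -> (open_hpoly rk s t)`_0 = 1.
Proof.
rewrite le_eqVlt /open_hpoly => /predU1P[->|st]; first by rewrite eqxx coef1.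
by rewrite (lt_eqF st); case: (sph st).
Qed.

(** Every value of the Chow function has constant coefficient 1.  Evaluated at 0,
    its recursion says that the signs (-1)^(rk w - rk s), s < w <= t, add up to
    -1, which is the recursion of the Moebius function up to signs. *)
Lemma eulerian_of_spherical : eulerian P.
Proof.
have key s t : (s < t)%O ->
    \sum_(w : P | (s < w <= t)%O) (-1) ^+ (rk w - rk s) = (-1)%R :> int.
  move=> st; have := open_hpoly_coef0 (ltW st); rewrite (open_hpoly_rec rk_lt st).
  rewrite coef_sum => e; rewrite -[in RHS]e -sumrN; apply: eq_bigr => w /andP[sw wt].
  rewrite -horner_coef0 hornerM horner_exp !hornerE horner_coef0 open_hpoly_coef0 // mulr1.
  by have := rk_lt sw; rewrite -subn_gt0; case: (_ - _)%N => // n _; rewrite exprS mulN1r.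
move=> s t; rewrite /rho_int !rhoE.
move: {2}(rk t - rk s)%N (leqnn (rk t - rk s)) => n; elim: n s => [|n IHn] s ln st.
  have -> : s = t.
    apply/eqP; move: st; rewrite le_eqVlt => /orP[//|/rk_lt]; rewrite -subn_gt0.
    by rewrite ltnNge ln.
  by rewrite /mobius inc_inv_unfold eqxx subnn /zeta invr1.
case: (eqVneq s t) => [->|nst].
  by rewrite /mobius inc_inv_unfold eqxx subnn /zeta invr1.
have lst : (s < t)%O by rewrite lt_neqAle nst.
rewrite /mobius inc_inv_unfold (negbTE nst) /zeta invr1 mul1r.
rewrite -[RHS]mulr1 -[X in _ * X]opprK -[X in _ * - X](key s t lst) mulrN; congr (- _).
rewrite mulr_sumr.
apply: eq_bigr => w /andP[sw wt]; rewrite mul1r -/(mobius w t) IHn //; last first.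
  by have := rk_lt sw; have := rk_le rk_lt wt; move: ln; clear; lia.
have -> : (rk t - rk s = (rk t - rk w) + (rk w - rk s))%N.
  by have := rk_lt sw; have := rk_le rk_lt wt; clear; lia.
by rewrite exprD -mulrA -exprD addnn -mul2n exprM sqrrN !expr1n mulr1.
Qed.
End Certificate.

(** * The poset of a ranked sphere *)
Section Extend.
Variables (T : finType) (V : {set T}) (E : rel T) (d : nat).
Hypotheses (symE : symmetric E) (irrE : irreflexive E) (hV : hsphere E V d).

(** The empty simplex is a cycle, and it bounds only if there is a vertex. *)
Lemma acyclic_nonempty (J : {set T}) m : acyclic E J m.+1 -> exists x, x \in J.
Proof.
move=> hJ; pose c : {ffun {set T} -> rat} := [ffun A => (A == set0)%:R].
have hc : chain_on E J 0 c.
  move=> A; rewrite ffunE; case: (eqVneq A set0) => [->|_]; last by rewrite eqxx.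
  by rewrite clique0 cards0.
have bc : boundary c = 0.
  rewrite boundaryE big1 // => x _; exact: del_chain0 hc.
have [e he be] := hJ 0 isT c hc bc.
case: (set_0Vmem J) => [J0|[x xJ]]; last by exists x.
have e0 : e = 0.
  apply/ffunP => A; rewrite [RHS]ffunE; apply/eqP; apply: contraT => /he[/cliqueP[sA _] cA].
  have /card_gt0P[x /sA] : (0 < #|A|)%N by rewrite cA.
  by rewrite J0 inE.
by move/ffunP/(_ set0)/eqP: be; rewrite e0 raddf0 !ffunE eqxx eq_sym oner_eq0.
Qed.

Lemma pairwise_clique A : clique E V A -> pairwise E (enum A).
Proof.
move=> /cliqueP[_ hA]; have := enum_uniq A; rewrite uniq_pairwise.
apply: (sub_in_pairwise (P := mem A)) => [x y xA yA /=|]; first exact: hA.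
by apply/allP => x; rewrite mem_enum.
Qed.

Lemma clique_hsphere A : clique E V A -> hsphere E (link E V (enum A)) (d - #|A|).
Proof.
move=> hA; rewrite cardE; apply: hsphere_link => //; last exact: pairwise_clique.
by move=> x; rewrite mem_enum; case/cliqueP: hA => sA _ /sA.
Qed.

(** Purity of Cohen-Macaulay complexes: the link of a clique with fewer than d
    elements is nonempty. *)
Lemma clique_extend A : clique E V A ->
  exists B : {set T}, [/\ A \subset B, clique E V B & #|B| = d].
Proof.
move: {2}(d - #|A|)%N (erefl (d - #|A|)%N) => k; elim: k A => [|k IHk] A dA hA.
  exists A; split=> //; apply/eqP; rewrite eqn_leq.
  by rewrite (spherical_bounded (hsphere_spherical hV) hA) -subn_eq0 dA.
have := spherical_acyclic (hsphere_spherical (clique_hsphere hA));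
    rewrite dA => /acyclic_nonempty[x].
rewrite in_link => /andP[xV /allP hx].
have xA : x \notin A.
  by apply/negP => xA; have := hx x; rewrite mem_enum xA irrE => /(_ isT).
have hxA : clique E V (x |: A).
  rewrite cliqueU1 // xV; case/cliqueP: hA => sA hA; apply/cliqueP; split=> // y yA.
  by rewrite inE sA //= symE; apply: hx; rewrite mem_enum.
have [|B [sB hB cB]] := IHk (x |: A) _ hxA.
  by rewrite cardsU1 xA add1n subnS dA.
by exists B; split=> //; apply: subset_trans sB; exact: subsetUr.
Qed.
End Extend.

(** The type T0 is eta-expanded so that the finite type structure that the poset
    inherits is convertible to T: sets of elements of the poset and sets of
    vertices of the graph are then the same objects, with the same orientations. *)
Section Poset.
Variables (T0 : finType).
Local Notation T := (Finite.Pack (Finite.class T0)).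
Variables (bot top : T) (E : rel T) (r : T -> nat) (d : nat).
Hypotheses (bt : bot != top) (hV : ranked_sphere (~: [set bot; top]) E r d).
Local Notation V := (~: [set bot; top]).

Definition bounded_le : rel T := fun x y =>
  [|| x == y, x == bot, y == top | E x y && (r x < r y)%N].

Let symE := sphere_sym hV.
Let irrE := sphere_irr hV.

Lemma sphere_neq x y : E x y -> [/\ x != bot, x != top, y != bot & y != top].
Proof.
move=> Exy; have := sphere_suppl hV Exy; have := sphere_suppr hV Exy.
by rewrite !inE !negb_or => /andP[-> ->] /andP[-> ->].
Qed.

Fact bounded_le_refl : reflexive bounded_le.
Proof. by move=> x; rewrite /bounded_le eqxx. Qed.

Fact bounded_le_anti : antisymmetric bounded_le.
Proof.
move=> x y; rewrite /bounded_le; case: (eqVneq x y) => //= xy.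
case: (boolP (E x y)) => Exy.
  have [/negbTE-> /negbTE-> /negbTE-> /negbTE->] := sphere_neq Exy.
  by rewrite symE Exy /= => /andP[/ltn_trans h /h]; rewrite ltnn.
rewrite symE (negbTE Exy) !orbF => /andP[] /orP[] /eqP e1 /orP[] /eqP e2.
- by rewrite e1 e2.
- by move: bt; rewrite -e1 -e2 eqxx.
- by move: bt; rewrite -e1 -e2 eqxx.
- by rewrite e1 e2.
Qed.

Fact bounded_le_trans : transitive bounded_le.
Proof.
move=> y x z; rewrite /bounded_le.
case: (eqVneq x y) => [->//|xy] /=; case: (eqVneq y z) => [->|yz] /=.
  by move=> h _; rewrite h orbT.
case: (eqVneq x bot) => [->|xb] /=; first by rewrite orbT.
case: (eqVneq z top) => [->|zt] /=; first by rewrite !orbT.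
rewrite ?orbF; case: (boolP (E x y)) => Exy /=; last first.
  rewrite orbF => /eqP ey; rewrite ey; case: (boolP (E top z)) => [/sphere_neq[]|_].
    by rewrite eqxx.
  by rewrite orbF eq_sym (negbTE bt).
have [_ _ /negbTE yb /negbTE yt] := sphere_neq Exy; rewrite yb yt /= => lxy.
case/andP=> Eyz lyz; rewrite (sphere_trans hV Exy Eyz lxy lyz) (ltn_trans lxy lyz).
by rewrite !orbT.
Qed.

Definition bounded_poset of bot != top & ranked_sphere V E r d : Type := T.
Local Notation P := (bounded_poset bt hV).

HB.instance Definition _ := Finite.on P.
HB.instance Definition _ := Order.Le_isPOrder.Build (Order.Disp tt tt) P
  bounded_le_refl bounded_le_anti bounded_le_trans.

Fact bounded_le_bot (x : P) : ((bot : P) <= x)%O.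
Proof. by rewrite /Order.le /= /bounded_le eqxx orbT. Qed.
Fact bounded_le_top (x : P) : (x <= (top : P))%O.
Proof. by rewrite /Order.le /= /bounded_le eqxx !orbT. Qed.

HB.instance Definition _ := Order.hasBottom.Build _ P bounded_le_bot.
HB.instance Definition _ := Order.hasTop.Build _ P bounded_le_top.

Definition bounded_rank (x : P) : nat :=
  if x == bot then 0 else if x == top then d.+1 else r x.

Lemma in_proper (x : T) : (x \in V) = (x != bot) && (x != top).
Proof. by rewrite !inE negb_or. Qed.

Lemma bounded_leE (x y : P) :
  (x <= y)%O = [|| x == y, x == bot, y == top | E x y && (r x < r y)%N].
Proof. by []. Qed.

Lemma botE : (\bot%O : P) = bot. Proof. by []. Qed.
Lemma topE : (\top%O : P) = top. Proof. by []. Qed.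

Lemma bounded_ltV (x y : P) : x \in V -> y \in V -> (x < y)%O = E x y && (r x < r y)%N.
Proof.
rewrite !in_proper => /andP[/negbTE xb /negbTE xt] /andP[/negbTE yb /negbTE yt].
rewrite lt_neqAle bounded_leE xb yt /=.
by case: (eqVneq x y) => [->|]; rewrite ?irrE.
Qed.

Lemma strict_cmpV (x y : P) : x \in V -> y \in V -> strict_cmp x y = E x y.
Proof.
move=> xV yV; rewrite /strict_cmp /Order.comparable ![(_ <= _)%O]le_eqVlt !bounded_ltV //.
case: (eqVneq x y) => [->|xy] /=; first by rewrite irrE.
rewrite [E y x]symE -andb_orr; case: (boolP (E x y)) => // /(sphere_adj hV).
by rewrite neq_ltn.
Qed.

Lemma bounded_rankV (x : P) : x \in V -> bounded_rank x = r x.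
Proof. by rewrite in_proper /bounded_rank => /andP[/negbTE-> /negbTE->]. Qed.

Lemma bounded_rank_bot : bounded_rank bot = 0.
Proof. by rewrite /bounded_rank eqxx. Qed.

Lemma bounded_rank_top : bounded_rank top = d.+1.
Proof. by rewrite /bounded_rank eq_sym (negbTE bt) eqxx. Qed.

Lemma bounded_cases (x : P) : [\/ x = bot, x = top | x \in V].
Proof.
rewrite in_proper; case: (eqVneq x bot) => [->|xb]; first by constructor 1.
by case: (eqVneq x top) => [->|xt]; [constructor 2|constructor 3].
Qed.

Lemma bounded_rank_lt (x y : P) : (x < y)%O -> (bounded_rank x < bounded_rank y)%N.
Proof.
case: (bounded_cases x) => [->|->|xV]; case: (bounded_cases y) => [->|->|yV].
- by rewrite ltxx.
- by rewrite bounded_rank_bot bounded_rank_top.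
- by rewrite bounded_rank_bot bounded_rankV //; case/andP: (sphere_rank hV yV).
- by move/lt_geF; rewrite bounded_le_top.
- by rewrite ltxx.
- by move/lt_geF; rewrite bounded_le_top.
- by move/lt_geF; rewrite bounded_le_bot.
- by rewrite bounded_rank_top bounded_rankV // ltnS; case/andP: (sphere_rank hV xV).
- by rewrite bounded_ltV // !bounded_rankV // => /andP[].
Qed.

Lemma bounded_rank_max (x : P) : (bounded_rank x <= d.+1)%N.
Proof.
case: (bounded_cases x) => [->|->|xV]; rewrite ?bounded_rank_bot ?bounded_rank_top //.
by rewrite bounded_rankV //; case/andP: (sphere_rank hV xV) => _ /leqW.
Qed.

Lemma bounded_flags (C : {set P}) : is_chain C ->
  exists F : {set P}, [/\ is_chain F, C \subset F & #|F| = d.+2].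
Proof.
move=> hC; have hA : clique E V (C :&: V).
  apply/cliqueP; split=> [x|x y]; rewrite inE => /andP[xC xV] //.
  rewrite inE => /andP[yC yV] xy; rewrite -strict_cmpV // /strict_cmp xy.
  by move/is_chainP: hC; apply.
have [B [sB hB cB]] := clique_extend symE irrE (sphere_hsphere hV) hA.
have BV x : x \in B -> x \in V by case/cliqueP: hB => sBV _ /sBV.
exists (bot |: (top |: B)); split.
- apply/is_chainP => x y; rewrite !inE => /or3P[/eqP->|/eqP->|xB].
  + by move=> _; rewrite /Order.comparable bounded_le_bot.
  + by move=> _; rewrite /Order.comparable bounded_le_top orbT.
  case/or3P => [/eqP->|/eqP->|yB].
  + by rewrite /Order.comparable bounded_le_bot orbT.
  + by rewrite /Order.comparable bounded_le_top.
  case: (eqVneq x y) => [->|xy]; first exact: comparablexx.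
  case/cliqueP: hB => _ /(_ x y xB yB xy); rewrite -strict_cmpV ?BV // => /andP[] //.
- apply/subsetP => x xC; rewrite !inE; case: (bounded_cases x) => [->|->|xV].
  + by rewrite eqxx.
  + by rewrite eqxx orbT.
  by rewrite (subsetP sB) ?orbT // inE xC.
rewrite !cardsU1 cB !inE negb_or bt /=.
have nb : bot \notin B by apply/negP => /BV; rewrite in_proper eqxx.
have nt : top \notin B by apply/negP => /BV; rewrite in_proper eqxx andbF.
by rewrite nb nt.
Qed.

(** The open interval ]s, t[ is the link of the elements of a flag through s and
    t that lie below s or above t.  An element y of that link cannot lie outside
    the interval, because the flag contains an element of the rank of y. *)
Lemma bounded_poset_spherical (s t : P) : (s < t)%O ->
  spherical strict_cmp (open_itv s t) (bounded_rank t - bounded_rank s).-1.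
Proof.
move=> st; have rk_lt := bounded_rank_lt.
have [|F [hF sF cF]] := @bounded_flags [set s; t].
  apply/is_chainP => x y; rewrite !inE => /orP[]/eqP-> /orP[]/eqP->;
      rewrite ?comparablexx //.
    by rewrite /Order.comparable (ltW st).
  by rewrite /Order.comparable (ltW st) orbT.
have [sF' tF] : s \in F /\ t \in F by split; apply: (subsetP sF); rewrite !inE eqxx ?orbT.
have inj := chain_rk_inj rk_lt hF.
have ltF x : x \in F -> (bounded_rank x < d.+2)%N by move=> _;
    rewrite ltnS bounded_rank_max.
have leF x y : x \in F -> y \in F -> (x <= y)%O = (bounded_rank x <= bounded_rank y)%N.
  move=> xF yF; have /orP[xy|yx] : (x >=< y)%O by move/is_chainP: hF; apply.
    by rewrite xy (rk_le rk_lt).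
  case: (eqVneq x y) => [->|xy]; first by rewrite lexx leqnn.
  have {}yx : (y < x)%O by rewrite lt_neqAle eq_sym xy.
  by rewrite leqNgt rk_lt // lt_geF.
have inVrk (x : P) : (x \in V) = (0 < bounded_rank x < d.+1)%N.
  case: (bounded_cases x) => [->|->|xV].
  - by rewrite in_proper eqxx bounded_rank_bot.
  - by rewrite in_proper eqxx andbF bounded_rank_top ltnn andbF.
  by rewrite xV bounded_rankV // ltnS (sphere_rank hV xV).
pose S : {set T} := [set x : P | (x \in F) && ((x \in V) && ((x <= s)%O || (t <= x)%O))].
have inS (x : P) : (x \in S) = (x \in F) && ((x \in V) && ((x <= s)%O || (t <= x)%O)).
  by rewrite inE.
have cS : #|S| = (d - (bounded_rank t - bounded_rank s).-1)%N.
  have := @count_iota_outside (bounded_rank s) (bounded_rank t) d.+1.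
  rewrite rk_lt // bounded_rank_max => /(_ isT).
  rewrite -(full_rank_card _ inj ltF cF) => e;
      apply: etrans (_ : _ = (d.+1 - (bounded_rank t - bounded_rank s).-1).-1) _;
      last first.
    by have := rk_lt _ _ st; have := bounded_rank_max t; clear; lia.
  rewrite -e; apply: eq_card => x; rewrite inS [RHS]inE; case: (boolP (x \in F)) => //= xF.
  by rewrite inVrk !leF // andbA.
have hS : clique E V S.
  apply/cliqueP; split=> [x|x y]; first by rewrite inS => /and3P[].
  rewrite !inS => /and3P[xF xV _] /and3P[yF yV _] xy;
      rewrite -strict_cmpV // /strict_cmp xy.
  by move/is_chainP: hF; apply.
have := hsphere_spherical (clique_hsphere symE (sphere_hsphere hV) hS).
have -> : link E V (enum S) = open_itv s t.
  apply/setP => y; rewrite in_link [RHS]inE; apply/andP/andP => [[yV /allP hy]|[sy yt]].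
    have adjS (x : P) : x \in S -> E x y by move=> xS; apply: hy; rewrite mem_enum.
    have noF (x : P) : x \in S -> bounded_rank x = bounded_rank y -> False.
      move=> xS; have xV : x \in V by move: xS; rewrite inS => /and3P[].
      rewrite !bounded_rankV // => e; have := sphere_adj hV (adjS x xS).
      by rewrite e eqxx.
    have yr : (0 < bounded_rank y < d.+1)%N by rewrite -inVrk.
    have [x xF xr] : exists2 x, x \in F & bounded_rank x = bounded_rank y.
      by apply: full_rank_onto inj ltF cF _; case/andP: yr => _ /ltnW.
    have xV : x \in V by rewrite inVrk xr.
    have xS : ~~ ((x <= s)%O || (t <= x)%O).
      by apply/negP => xst; apply: (noF x) => //; rewrite inS xF xV.
    have [sx tx] : (bounded_rank s < bounded_rank y)%N /\ (bounded_rank y < bounded_rank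
        t)%N.
      by move: xS; rewrite !leF // xr negb_or -!ltnNge => /andP[].
    split.
      case: (bounded_cases s) => [->|es|sV].
      - by rewrite lt_neqAle eq_sym bounded_le_bot andbT; move: yV;
          rewrite in_proper => /andP[].
      - by move: st; rewrite es => /lt_geF; rewrite bounded_le_top.
      rewrite bounded_ltV // adjS ?inS ?sF' ?sV ?lexx //.
      by move: sx; rewrite !bounded_rankV.
    case: (bounded_cases t) => [et|->|tV].
    - by move: st; rewrite et => /lt_geF; rewrite bounded_le_bot.
    - by rewrite lt_neqAle bounded_le_top andbT; move: yV; rewrite in_proper => /andP[].
    rewrite bounded_ltV // symE adjS ?inS ?tF ?tV ?lexx ?orbT //.
    by move: tx; rewrite !bounded_rankV.
  have yV : y \in V.
    rewrite inVrk; have := rk_lt _ _ sy; have := rk_lt _ _ yt.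
    by have := bounded_rank_max t; clear; lia.
  split=> //; apply/allP => x; rewrite mem_enum inS => /and3P[xF xV /orP[xs|tx]].
    by have := le_lt_trans xs sy; rewrite bounded_ltV // => /andP[].
  by have := lt_le_trans yt tx; rewrite bounded_ltV // symE => /andP[].
rewrite cS subKn; last first.
  by have := rk_lt _ _ st; have := bounded_rank_max t; clear; lia.
apply: eq_spherical => x y; rewrite !inE => /andP[sx xt] /andP[sy yt].
have bV (z : P) : (s < z)%O -> (z < t)%O -> z \in V.
  rewrite inVrk => /rk_lt + /rk_lt; have := bounded_rank_max t; clear; lia.
by rewrite strict_cmpV // bV.
Qed.

Lemma bounded_posetP :
  [/\ graded P, gorenstein_star P, poset_rank P = d.+1 &
      eulerian_chow_poly P = hpoly E V d].
Proof.
have rk_lt := bounded_rank_lt.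
have rk_max := bounded_rank_max; have flags := bounded_flags.
have sph := bounded_poset_spherical.
split.
- exact: graded_of_flags flags.
- split; first exact: eulerian_of_spherical rk_lt rk_max flags sph.
  exact: cohen_macaulay_of_spherical sph.
- by rewrite /poset_rank (rhoE rk_lt rk_max flags) topE bounded_rank_top.
rewrite /eulerian_chow_poly (chow_functionE rk_lt rk_max flags) //.
rewrite /open_hpoly botE topE (negbTE bt) bounded_rank_top bounded_rank_bot subn0 /=.
have -> : open_itv (bot : P) (top : P) = V.
  apply/setP => x; rewrite !inE negb_or !lt_neqAle bounded_le_bot bounded_le_top !andbT.
  by rewrite eq_sym.
by apply: eq_hpoly => x y xV yV; rewrite strict_cmpV.
Qed.
End Poset.

(** Destructing T makes the eta-expansion above a conversion. *)
Lemma poset_of_ranked_sphere (T : finType) (bot top : T) E r d :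
    bot != top -> ranked_sphere (~: [set bot; top]) E r d ->
  exists (disp : Order.disp_t) (P : finTBPOrderType disp),
    [/\ graded P, gorenstein_star P, poset_rank P = d.+1 &
        eulerian_chow_poly P = hpoly E (~: [set bot; top]) d].
Proof.
case: T bot top E r => T cT bot top E r bt hV.
exists (Order.Disp tt tt),
    (@bounded_poset (Finite.Pack cT) bot top E r d bt hV : finTBPOrderType _).
exact: (@bounded_posetP (Finite.Pack cT) bot top E r d bt hV).
Qed.

(** * Real-rootedness and log-concavity *)

(** Log-concavity together with the absence of internal zeros, in the form that
    is preserved by products with X + y. *)
Definition strongly_log_concave (p : {poly algC}) : Prop :=
  (forall i, 0 <= p`_i) /\
  (forall i j, (i <= j)%N -> p`_i * p`_j.+2 <= p`_i.+1 * p`_j.+1).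

Lemma strongly_log_concaveZ c p : 0 <= c ->
  strongly_log_concave p -> strongly_log_concave (c *: p).
Proof.
move=> c0 [hp hlc]; split=> [i|i j ij]; rewrite !coefZ ?mulr_ge0 //.
by rewrite !mulrA ![c * _ * c]mulrAC -!mulrA !ler_wpM2l ?mulr_ge0 ?hlc.
Qed.

(** Written as a polynomial in y, the difference of the two sides of each
    inequality for the product has coefficients that are nonnegative by the
    inequalities for p. *)
Lemma strongly_log_concave_mulXaddC y p : 0 <= y ->
  strongly_log_concave p -> strongly_log_concave (('X + y%:P) * p).
Proof.
move=> y0 [a0 hlc].
have b0 : (('X + y%:P) * p)`_0 = y * p`_0.
  by rewrite mulrDl coefD coefXM coefCM add0r.
have bS i : (('X + y%:P) * p)`_i.+1 = p`_i + y * p`_i.+1.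
  by rewrite mulrDl coefD coefXM coefCM.
split=> [[|i]|[|i] [|j] ij //]; rewrite ?b0 ?bS ?mulr_ge0 ?addr_ge0 ?mulr_ge0 //.
- rewrite -subr_ge0.
  have -> : (p`_0 + y * p`_1) * (p`_0 + y * p`_1) - y * p`_0 * (p`_1 + y * p`_2) =
    p`_0 * p`_0 + y * (p`_0 * p`_1) + y * y * (p`_1 * p`_1 - p`_0 * p`_2) by ring.
  by rewrite !addr_ge0 ?mulr_ge0 // subr_ge0 hlc.
- rewrite -subr_ge0.
  have -> : (p`_0 + y * p`_1) * (p`_j.+1 + y * p`_j.+2) - y * p`_0 * (p`_j.+2 + y *
      p`_j.+3) =
    p`_0 * p`_j.+1 + y * (p`_1 * p`_j.+1) + y * y * (p`_1 * p`_j.+2 - p`_0 * p`_j.+3) by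
        ring.
  by rewrite !addr_ge0 ?mulr_ge0 // subr_ge0 hlc.
have h3 : p`_i * p`_j.+3 <= p`_i.+2 * p`_j.+1.
  apply: le_trans (hlc i j.+1 (leqW ij)) _; rewrite ltnS in ij.
  move: ij; rewrite leq_eqVlt => /predU1P[->|ij]; first by rewrite mulrC.
  exact: hlc.
rewrite -subr_ge0.
have -> : (p`_i.+1 + y * p`_i.+2) * (p`_j.+1 + y * p`_j.+2)
     - (p`_i + y * p`_i.+1) * (p`_j.+2 + y * p`_j.+3) =
   (p`_i.+1 * p`_j.+1 - p`_i * p`_j.+2)
   + y * y * (p`_i.+2 * p`_j.+2 - p`_i.+1 * p`_j.+3)
   + y * (p`_i.+2 * p`_j.+1 - p`_i * p`_j.+3) by ring.
have yy : 0 <= y * y by rewrite mulr_ge0.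
apply: addr_ge0; first apply: addr_ge0.
- by rewrite subr_ge0 hlc.
- by apply: mulr_ge0 => //; rewrite subr_ge0 hlc.
- by apply: mulr_ge0 => //; rewrite subr_ge0.
Qed.

Lemma real_rooted_log_concave (p : {poly int}) :
  nonneg_coefs p -> real_rooted p -> log_concave p.
Proof.
move=> hp rp; case: (eqVneq p 0) => [->|pn0]; first by move=> i;
    rewrite !coef0 mul0r expr0n.
pose q : {poly algC} := map_poly intr p.
have qE i : q`_i = (p`_i)%:~R by rewrite coef_map.
have q0 i : 0 <= q`_i by rewrite qE ler0z.
have qn0 : q != 0 by rewrite map_poly_eq0_id0 // intr_eq0 lead_coef_eq0.
have [rs qrs] := closed_field_poly_normal q.
have lq0 : lead_coef q != 0 by rewrite lead_coef_eq0.
have rs_le0 z : z \in rs -> z <= 0.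
  move=> zrs; have rz : root q z.
    by rewrite qrs rootZ // root_prod_XsubC.
  have zreal := rp z rz; rewrite real_leNgt ?real0 //; apply/negP => z0.
  have : 0 < q.[z].
    rewrite horner_coef (polySpred qn0) big_ord_recr /= ltr_wpDl //.
      by apply: sumr_ge0 => i _; rewrite mulr_ge0 // exprn_ge0 // ltW.
    by rewrite mulr_gt0 ?exprn_gt0 // lt_neqAle eq_sym q0 andbT.
  by rewrite (eqP rz) ltxx.
have slc : strongly_log_concave q.
  rewrite qrs; apply: strongly_log_concaveZ; first exact: q0.
  elim: (rs) rs_le0 => [|z s IHs] hz.
    rewrite big_nil; split=> [i|i j _]; first by rewrite coef1 ler0n.
    by rewrite !coef1 /= !mulr0.
  rewrite big_cons -[z]opprK polyCN opprK; apply: strongly_log_concave_mulXaddC.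
    by rewrite oppr_ge0 hz ?mem_head.
  by apply: IHs => y ys; apply: hz; rewrite inE ys orbT.
move=> i; have := slc.2 i i (leqnn i).
by rewrite !qE -!intrM ler_int expr2.
Qed.

(** * The example *)
Lemma coef_XaddC1_exp (R : comNzRingType) n i : (('X + 1 : {poly R}) ^+ n)`_i = 'C(n, i)%:R.
Proof.
elim: n i => [|n IHn] [|i]; rewrite ?expr0 ?coef1 ?bin0n ?bin0 //.
  by rewrite exprS mulrDl mul1r coefD coefXM add0r IHn bin0.
by rewrite exprS mulrDl mul1r coefD coefXM /= !IHn binS natrD addrC.
Qed.

Section Instance.
Local Notation x i := (@Ordinal 8 i isT, true).
Local Notation y i := (@Ordinal 8 i isT, false).

(** The last subdivision comes first.  The two single ones make y_2 incomparable
    to x_1 and y_3 incomparable to x_4, so that the edge y_2 y_3 forms a clique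
    with none of the three edges that are subdivided after it. *)
Definition chosen_ops (n k : nat) : seq (('I_8 * bool) * ('I_8 * bool) * nat) :=
  [:: ((x 4, x 5), n); ((x 2, x 3), n); ((x 0, x 1), n);
      ((y 2, y 3), k); ((y 3, x 4), 1%N); ((x 1, y 2), 1%N)].

Lemma valid_chosen_ops n k : (0 < n)%N -> (0 < k)%N -> valid_ops (chosen_ops n k).
Proof. by move=> n0 k0; rewrite /= n0 k0. Qed.

Lemma ops_hpoly_chosen n k (b := n.*2%:R : int) (c := k.*2%:R : int) :
  ops_hpoly (chosen_ops n k) [::] =
    ('X + 1) ^+ 8 + (4 + 3 * b + c)%:P * ('X * ('X + 1) ^+ 6)
    + (4 + 4 * b + 3 * b ^+ 2)%:P * ('X^2 * ('X + 1) ^+ 4)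
    + (b ^+ 3)%:P * ('X^3 * ('X + 1) ^+ 2).
Proof.
rewrite /= (_ : 1.*2%:R = 2%:R :> int) // -/b -/c -!mul_polyC.
by clearbody b c; ring.
Qed.
End Instance.

Theorem theorem1p7 :
  exists (d : Order.disp_t) (P : finTBPOrderType d),
    [/\ graded P,
        gorenstein_star P,
        poset_rank P = 9%N,
        nonneg_coefs (eulerian_chow_poly P) &
        ~ log_concave (eulerian_chow_poly P) /\
        ~ real_rooted (eulerian_chow_poly P)].
Proof.
pose ops := chosen_ops 50 500.
pose T : finType := (bool + (('I_8 * bool) + 'I_(vertices_added ops)))%type.
pose bot : T := inl false; pose top : T := inl true.
pose emb (a : 'I_8 * bool) : T := inr (inl a).
pose W : {set T} := [set inr (inr k) | k in 'I_(vertices_added ops)].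
have emb_inj : injective emb by move=> a b [].
have VW : ~: [set bot; top] = cross_part emb setT :|: W.
  apply/setP => -[[]|[a|k]]; rewrite !inE.
  - by apply/esym/negbTE/norP; split; apply/imsetP => -[].
  - by apply/esym/negbTE/norP; split; apply/imsetP => -[].
  - by rewrite in_cross_part // inE.
  - by apply/esym; rewrite orbC mem_imset // => i j [].
have dW : [disjoint cross_part emb setT & W].
  by apply/pred0P => z /=; apply/negP => /andP[/cross_partP[a -> _] /imsetP[]].
have cW : #|W| = vertices_added ops by rewrite card_imset ?card_ord // => i j [].
have [E [r [hS _ _ hE]]] := ops_ranked_sphere emb_inj (@valid_chosen_ops 50 500 isT isT)
    dW cW.
rewrite -VW in hS hE.
have [disp [P [gP GP rP chowP]]] := @poset_of_ranked_sphere T bot top E r 8 isT hS.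
have {chowP hE} chowP : eulerian_chow_poly P = ops_hpoly ops [::] by rewrite chowP -(hE
    [::]).
rewrite ops_hpoly_chosen in chowP.
move: chowP; rewrite (_ : 50.*2%:R = 100 :> int) // (_ : 500.*2%:R = 1000 :> int) //.
set g1 : int := 4 + 3 * 100 + 1000; set g2 : int := 4 + 4 * 100 + 3 * 100 ^+ 2.
set g3 : int := 100 ^+ 3 => chowP.
have coefP i : (eulerian_chow_poly P)`_i =
    'C(8, i)%:R + g1 * (if i == 0 then 0 else 'C(6, i.-1)%:R)
    + g2 * (if (i < 2)%N then 0 else 'C(4, i - 2)%:R)
    + g3 * (if (i < 3)%N then 0 else 'C(2, i - 3)%:R).
  by rewrite chowP !coefD !coefCM coefXM !coefXnM !coef_XaddC1_exp.
have nnP : nonneg_coefs (eulerian_chow_poly P).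
  move=> i; rewrite coefP; do ! apply: addr_ge0; rewrite ?ler0n //;
    apply: mulr_ge0 => //; case: ifP => // _; exact: ler0n.
have nlcP : ~ log_concave (eulerian_chow_poly P).
  move=> /(_ 1%N); rewrite !coefP /=.
  have [-> -> -> ->] : [/\ 'C(8, 1) = 8, 'C(8, 2) = 28, 'C(8, 3) = 56 & 'C(6,
      2) = 15]%N by [].
  by rewrite bin0 !bin1 subnn bin0 bin0 /g1 /g2 /g3; lia.
exists disp, P; split=> //; split=> // rrP; exact/nlcP/real_rooted_log_concave.
Qed.
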